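(* For every positive integer $n$, let $KS_{n,n}$ be the two-sample Kolmogorov--Smirnov statistic for two samples of equal size $n$ (see context), and for $M>0$ let $P_{n,n,M}=\Pr(KS_{n,n}\ge M)$ under the null hypothesis. Then: (a) For every $n\ge 1$ and every $M>0$, $P_{n,n,M}\le e\cdot\exp(-2M^2)$, i.e. the DKW inequality holds with $C=e$. (b) For every $n\ge 4$ and every $M>0$, $P_{n,n,M}\le 2.16863\,\exp(-2M^2)$. (Here $4$ is the smallest $n$ such that $H_0$ can be rejected at level $0.05$, i.e. such that some possible value $M$ of $KS_{n,n}$ has $P_{n,n,M}\le 0.05$.) (c) For every $n\ge 458$ and every $M>0$, $P_{n,n,M}\le 2\exp(-2M^2)$. (d) For each integer $n$ with $1\le n<458$ there is some $M$ of the form $M=k/\sqrt{2n}$, $k\in\{1,\dots,n\}$, such that $P_{n,n,M}>2\exp(-2M^2)$. (e) For each integer $n$ with $1\le n<458$ there is some $\delta_n>0$ such that $P_{n,n,M}\le 2(1+\delta_n)\exp(-2M^2)$ for all $M>0$, where moreover for $12\le n\le 457$ the number $\delta_n$ satisfies $$\delta_n<-\frac{0.07}{n}+\frac{40}{n^2}-\frac{400}{n^3}.$$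
   Context: Null hypothesis $H_0$: $F_n$ and $G_n$ are independent empirical distribution functions, each based on $n$ observations, where all $2n$ observations are i.i.d. with a continuous distribution function $F$ on $\mathbb{R}$. Define $D_{n,n}=\sup_x|F_n(x)-G_n(x)|$ and $KS_{n,n}=\sqrt{n/2}\,D_{n,n}$. All probabilities are under $H_0$ (they do not depend on $F$). The possible nonzero values of $D_{n,n}$ are $k/n$, $k=1,\dots,n$, so those of $KS_{n,n}$ are $k/\sqrt{2n}$. The DKW inequality is said to hold for sample sizes $m=n$ with constant $C$ if $\Pr(KS_{n,n}\ge M)\le C\exp(-2M^2)$ for all $M>0$; the DKWM inequality is the case $C=2$. *)

(* Defs.v *)
From HB Require Import structures.
From mathcomp Require Import all_boot all_order all_algebra.
From mathcomp Require Import all_classical all_reals all_analysis.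

Set Implicit Arguments.
Unset Strict Implicit.
Unset Printing Implicit Defensive.

Import Order.TTheory GRing.Theory Num.Theory.
Import numFieldNormedType.Exports.

Local Open Scope classical_set_scope.
Local Open Scope ring_scope.

Definition ecdf (R : realType) (n : nat) (x : 'I_n -> R) (t : R) : R :=
  #|[pred i : 'I_n | x i <= t]|%:R / n%:R.

Definition KS_D (R : realType) (n : nat) (x y : 'I_n -> R) : R :=
  sup [set `|ecdf x t - ecdf y t| | t in [set: R]].

Definition KS_stat (R : realType) (n : nat) (x y : 'I_n -> R) : R :=
  Num.sqrt (n%:R / 2) * KS_D x y.

Definition mutually_independent (R : realType) (d : measure_display)
    (T : measurableType d) (P : probability T R) (I : finType)
    (Z : I -> {RV P >-> R}) : Prop :=
  forall (J : {set I}) (B : I -> set R), (forall i, measurable (B i)) ->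
    P (\bigcap_(i in [set` J]) (Z i @^-1` B i)) =
    (\prod_(i in J) P (Z i @^-1` B i))%E.

Definition pooled (A : Type) (n : nat) (X Y : 'I_n -> A) (s : 'I_n + 'I_n) : A :=
  match s with inl i => X i | inr j => Y j end.

Definition null_hypothesis (R : realType) (d : measure_display)
    (T : measurableType d) (P : probability T R) (n : nat)
    (X Y : 'I_n -> {RV P >-> R}) : Prop :=
  mutually_independent (pooled X Y) /\
  exists F : R -> R, continuous F /\
    forall (s : 'I_n + 'I_n) (t : R), cdf (pooled X Y s) t = (F t)%:E.

(* [under_H0 n M Q] says that P_{n,n,M} = Pr(KS_{n,n} >= M) satisfies Q.  The
   probability is the same in every model of the null hypothesis, so Q is
   required in all of them; choices made outside [under_H0] (of M or of a
   constant) are uniform in the model. *)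
Definition under_H0 (R : realType) (n : nat) (M : R) (Q : \bar R -> Prop)
    : Prop :=
  forall (d : measure_display) (T : measurableType d) (P : probability T R)
    (X Y : 'I_n -> {RV P >-> R}), null_hypothesis X Y ->
    Q (P [set w | M <= KS_stat (fun i => X i w) (fun i => Y i w)]).

Definition DKW (R : realType) (n : nat) (C : R) : Prop :=
  forall M : R, 0 < M ->
    under_H0 n M (fun p => (p <= (C * expR (- 2 * M ^+ 2))%:E)%E).

(* The nonzero possible values of KS_{n,n} are [KS_value R n k], 1 <= k <= n. *)
Definition KS_value (R : realType) (n k : nat) : R :=
  k%:R / Num.sqrt (2 * n%:R).

(* Main.v *)
(* Exchangeability of the pooled sample makes the set of ranks of the first sample
   uniform, so Pr(D_{n,n} >= k/n) is the proportion of balanced walks of length 2n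
   that reach distance k.  Truncating the reflection-principle sum gives, with
   rho_j = 'C(2n, n + j) / 'C(2n, n),
     2 (rho_k - rho_2k) <= Pr <= 2 (rho_k - rho_2k + rho_3k)  and  Pr <= 2 rho_k.
   Since rho_k is the product over i < k of (1 - u_i) / (1 + u_i) with
   u_i = (2i + 1) / (2n + 1), its logarithm is - 2 sum artanh u_i, and the first
   terms of the artanh series give rho_k <= exp(- k^2 / n) once k^2 >= 3n + 4.
   If k^2 <= 69 n / 100, the trivial bound Pr <= 1 is enough because 69 / 100 < ln 2.
   In between, rho_2k - rho_3k exceeds rho_k - exp(- k^2 / n) as soon as n >= 700; for
   n < 700 the finitely many pairs (n, k) are settled by fixed-point arithmetic with
   directed rounding. *)
From Stdlib Require Import BinNat Nnat.
From HB Require Import structures.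
Require Import Defs.
From mathcomp Require Import all_boot all_order all_algebra.
From mathcomp Require Import all_classical all_reals all_analysis.
From mathcomp Require Import measurable_realfun.
From mathcomp Require Import zify ring lra.
Import Order.TTheory GRing.Theory Num.Theory.
Import numFieldNormedType.Exports.
Local Open Scope ring_scope.
Set Implicit Arguments.
Unset Strict Implicit.
Unset Printing Implicit Defensive.

(** The law of the ranks is never constructed. For a realization without ties, the labels are varied
    instead: the n-subsets of the pooled index set for which the statistic is large are counted,
    with bounds independent of the realization. Integrating this count gives the probability,
    because exchangeability makes all n-subsets equally likely to deviate.

    The constant 458 defeats pure estimates. Put x = k^2 / n. To first order rho_k is exp(- x + x (1
    - x / 3) / (2 n)), so its excess over exp(- x) is positive up to x = 3, which is the origin of
    the cutoff 3n + 4, while the second reflection gains about exp(- 4 x), independently of n. The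
    gain wins when x (1 - x / 3) exp(3 x) < 2 n. The left side peaks near x = 2.7 at about 890, so
    the crossover lies close to n = 445, and sizes near it call for computation; from 700 on, rough
    estimates have enough room. *)

(** * Truncated reflection sums of binomial coefficients *)

(** Extension by zero to negative arguments: Pascal's rule and the symmetry then hold at every
    integer, so reflected indices carry no side conditions. *)
Definition binz (m : nat) (z : int) : int :=
  if z is Posz a then 'C(m, a)%:Z else 0.

Lemma binz_ge0 m z : 0 <= binz m z.
Proof. by case: z. Qed.

Lemma binzS m z : binz m.+1 z = binz m z + binz m (z - 1).
Proof.
case: z => [[|a]|a] //=; last first.
  by rewrite binS PoszD; congr (_ + 'C(m, _)%:Z); lia.
by rewrite !bin0.
Qed.

Lemma binz_sub m z : binz m (m%:Z - z) = binz m z.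
Proof.
case: z => [a|a].
  case: (leqP a m) => ham.
    by rewrite subzn //= bin_sub.
  have -> : m%:Z - Posz a = Negz (a - m).-1 by lia.
  by rewrite /= bin_small.
have -> : m%:Z - Negz a = Posz (m + a.+1) by lia.
by rewrite /= bin_small //; lia.
Qed.

(* The reflection-principle sum of (-1)^j 'C(m, a + j k) over j, truncated to
   |j| <= J. *)
Fixpoint bonf (J k m : nat) (a : int) : int :=
  if J is J'.+1 then
    bonf J' k m a +
      (-1) ^+ J * (binz m (a + (J * k)%N%:Z) + binz m (a - (J * k)%N%:Z))
  else binz m a.

Lemma bonfS J k m a : bonf J k m.+1 a = bonf J k m a + bonf J k m (a - 1).
Proof.
elim: J => [|J IH] /=; first exact: binzS.
rewrite IH !binzS.
have -> : a + (J.+1 * k)%N%:Z - 1 = a - 1 + (J.+1 * k)%N%:Z by lia.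
have -> : a - (J.+1 * k)%N%:Z - 1 = a - 1 - (J.+1 * k)%N%:Z by lia.
by ring.
Qed.

Lemma bonf_sub J k m a : bonf J k m (m%:Z - a) = bonf J k m a.
Proof.
elim: J => [|J IH] /=; first exact: binz_sub.
move: (J.+1 * k)%N => q; rewrite IH.
have -> : m%:Z - a + q%:Z = m%:Z - (a - q%:Z) by ring.
have -> : m%:Z - a - q%:Z = m%:Z - (a + q%:Z) by ring.
rewrite !binz_sub.
by ring.
Qed.

(** On this line the symmetry sends [a - (J + 1) k] to [a + J k], so each new pair cancels the
    surviving term of the previous one, and the sum telescopes. *)
Lemma bonf_boundary J k m a : 2 * a - m%:Z = k%:Z ->
  bonf J k m a = (-1) ^+ J * binz m (a + (J * k)%N%:Z).
Proof.
move=> ha; elim: J => [|J IH] /=; first by rewrite mul1r addr0.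
rewrite IH -(binz_sub m (a - _)).
have -> : m%:Z - (a - (J.+1 * k)%N%:Z) = a + (J * k)%N%:Z by lia.
by rewrite exprS; ring.
Qed.

Lemma bonf0 J k a : (0 < k)%N -> `|2 * a| <= k%:Z ->
  bonf J k 0 a = (a == 0)%:R.
Proof.
move=> k0 ha; elim: J => [|J IH] /=.
  by case: a ha => [[|a]|a].
rewrite IH.
have hk : (k <= J.+1 * k)%N by rewrite leq_pmull.
move: (J.+1 * k)%N hk => q hk.
have h0 z : z != 0 -> binz 0 z = 0 by case: z => [[|?]|?].
by rewrite !h0 ?addr0 ?mulr0 ?addr0 //; lia.
Qed.

(** * Walks staying within distance k, counted as subsets of an ordered finite set *)

Section Count.
Context {d : Order.disp_t} {V : orderType d} (T : finType) (z : T -> V).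
Hypothesis z_inj : injective z.
Variable k : nat.
Hypothesis k_gt0 : (0 < k)%N.

(** Height of the walk that has visited [B], going up at members of [S] and down at the other
    points. *)
Definition excess (S B : {set T}) : int := 2 * #|S :&: B|%:Z - #|B|%:Z.

Definition below (j : T) : {set T} := [set i | (z i < z j)%O].

(** The prefixes strictly below a point of [A] never exhaust [A], so the final position is tested
    separately. *)
Definition confined (A S : {set T}) : bool :=
  (`|excess S A| < k%:Z) &&
  [forall (j | j \in A), `|excess S (A :&: below j)| < k%:Z].

Definition confined_sets (A : {set T}) (a : int) : {set {set T}} :=
  [set S : {set T} | [&& S \subset A, #|S|%:Z == a & confined A S]].

Lemma confined_argmax (A S : {set T}) i : i \in A ->
  (forall j, j \in A -> (z j <= z i)%O) ->
  confined A S = (`|excess S A| < k%:Z) && confined (A :\ i) S.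
Proof.
move=> iA imax.
have bi : A :&: below i = A :\ i.
  apply/finset.setP => j; rewrite !inE andbC.
  case: (boolP (j \in A)) => jA; rewrite ?andbF //= !andbT.
  by rewrite lt_neqAle imax // andbT (inj_eq z_inj).
have bj j : j \in A -> A :&: below j = (A :\ i) :&: below j.
  move=> jA; apply/finset.setP => l; rewrite !inE andbC [in RHS]andbC.
  case: (boolP (z l < z j)%O) => //= lj; case: eqVneq => //= el.
  by move: lj; rewrite el ltNge imax.
rewrite /confined; congr (_ && _); apply/forallP/andP.
  move=> h; split.
    by have := h i; rewrite iA /= bi.
  apply/forallP => j; apply/implyP; rewrite inE => /andP[_ jA].
  by have := h j; rewrite jA /= bj.
move=> [h1 /forallP h2] j; apply/implyP => jA.
have [->|ji] := eqVneq j i; first by rewrite bi.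
by rewrite bj //; have := h2 j; rewrite !inE ji jA.
Qed.

Lemma excess_setU1 (A S : {set T}) i : i \notin A -> excess (i |: S) A = excess S A.
Proof.
move=> iA; rewrite /excess; suff -> : (i |: S) :&: A = S :&: A by [].
apply/finset.setP => j; rewrite !inE; case: eqVneq => //= ->.
by rewrite (negbTE iA) andbF.
Qed.

Lemma confined_setU1 (A S : {set T}) i : i \notin A ->
  confined A (i |: S) = confined A S.
Proof.
move=> iA; rewrite /confined excess_setU1 //; congr (_ && _).
apply/forallP/forallP => h j; have := h j; rewrite excess_setU1 //;
  by rewrite inE (negbTE iA).
Qed.

Lemma excess_sub (A S : {set T}) : S \subset A ->
  excess S A = 2 * #|S|%:Z - #|A|%:Z.
Proof. by move=> /finset.setIidPl; rewrite /excess => ->. Qed.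

(** The strict bound makes the test at the final position automatic. What remains is confinement on
    [A :\ i], which does not see whether [i] belongs to the set; the two terms are these two
    cases. *)
Lemma card_confinedS (A : {set T}) (i : T) (a : int) : i \in A ->
  (forall j, j \in A -> (z j <= z i)%O) -> `|2 * a - #|A|%:Z| < k%:Z ->
  #|confined_sets A a| =
  (#|confined_sets (A :\ i) a| + #|confined_sets (A :\ i) (a - 1)|)%N.
Proof.
move=> iA imax ha.
rewrite -(cardsID [set S : {set T} | i \in S] (confined_sets A a)) addnC.
congr (_ + _)%N.
  apply: eq_card => S; rewrite !inE finset.subsetD1 (confined_argmax _ iA) //.
  case: (boolP (S \subset A)) => SA; rewrite ?andbF //=.
  case: (boolP (i \in S)) => iS; rewrite ?andbF //=.
  case: eqP => //= Sa; by rewrite excess_sub // Sa ha.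
rewrite -[RHS](card_in_imset (f := fun S => i |: S)); last first.
  move=> S1 S2; rewrite !inE !finset.subsetD1.
  move=> /andP[/andP[_ i1] _] /andP[/andP[_ i2] _] e.
  by rewrite -(finset.setU1K i1) e finset.setU1K.
apply: eq_card => S; apply/idP/imsetP.
  rewrite !inE => /andP[/and3P[SA /eqP Sa cS] iS].
  exists (S :\ i); last by rewrite finset.setD1K.
  have SE : S = i |: (S :\ i) by rewrite finset.setD1K.
  rewrite inE finset.setSD //=; apply/andP; split.
    by have := cardsD1 i S; rewrite iS; lia.
  move: cS; rewrite (confined_argmax _ iA) // => /andP[_].
  by rewrite [in X in X -> _]SE confined_setU1 // !inE eqxx.
move=> [S']; rewrite !inE finset.subsetD1 => /andP[/andP[SA iS]] /andP[/eqP Sa cS] ->.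
have SA' : i |: S' \subset A by rewrite finset.subUset finset.sub1set iA.
have cc : #|i |: S'|%:Z = a by rewrite cardsU1 iS; lia.
rewrite !inE eqxx SA' cc eqxx /= (confined_argmax _ iA) // excess_sub // cc ha /=.
by rewrite confined_setU1 ?inE ?eqxx // cS.
Qed.

(* Removing the point of [A] with the largest value gives Pascal's rule for both
   terms; where |2 a - #|A|| = k the cardinal vanishes and [bonf_boundary] gives the
   sign of the truncated sum. *)
Lemma card_confined_bonf J (A : {set T}) (a : int) :
  `|2 * a - #|A|%:Z| <= k%:Z ->
  0 <= (-1) ^+ J * (bonf J k #|A| a - #|confined_sets A a|%:Z).
Proof.
move: {2}#|A| (erefl #|A|) => m; elim: m A a => [|m IH] A a cA ha.
  rewrite cA bonf0 //; last by move: ha; rewrite cA subr0.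
  have -> : A = finset.set0 by apply/eqP; rewrite -cards_eq0 cA.
  suff -> : confined_sets finset.set0 a =
      if a == 0 then [set finset.set0] else finset.set0.
    by case: eqP; rewrite ?cards1 ?cards0 subrr mulr0.
  apply/finset.setP => S; rewrite !inE finset.subset0.
  have [->|nS] := eqVneq S finset.set0; last first.
    by case: ifP; rewrite !inE ?(negbTE nS).
  rewrite cards0 eq_sym; case: ifP => _; rewrite !inE ?eqxx //=.
  apply/andP; split; first by rewrite /excess finset.setI0 cards0 ltz_nat.
  by apply/forallP => j; rewrite inE.
have [b1|b1] := eqVneq `|2 * a - #|A|%:Z| k%:Z.
  have -> : #|confined_sets A a| = 0%N.
    apply: eq_card0 => S; rewrite !inE; apply/negP => /and3P[SA /eqP Sa /andP[h _]].
    by move: h; rewrite excess_sub // Sa b1 ltxx.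
  rewrite subr0.
  have [h|h] : 2 * a - #|A|%:Z = k%:Z \/ 2 * (#|A|%:Z - a) - #|A|%:Z = k%:Z.
    by move: b1; lia.
    by rewrite bonf_boundary // mulrA -expr2 sqrr_sign mul1r binz_ge0.
  by rewrite -bonf_sub bonf_boundary // mulrA -expr2 sqrr_sign mul1r binz_ge0.
have ha' : `|2 * a - #|A|%:Z| < k%:Z by rewrite lt_neqAle b1.
have [i0 i0A] : exists i, i \in A by apply/finset.set0Pn; rewrite -cards_eq0 cA.
case: (@arg_maxP _ _ _ i0 (fun j => j \in A) z i0A) => i iA imax.
have cA' : #|A :\ i| = m by have := cardsD1 i A; rewrite iA cA => -[].
rewrite (card_confinedS iA) // cA bonfS PoszD.
have := IH (A :\ i) a cA'; have := IH (A :\ i) (a - 1) cA'; rewrite cA' => h1 h2.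
have {}h1 := h1 ltac:(move: ha'; rewrite cA; lia).
have {}h2 := h2 ltac:(move: ha'; rewrite cA; lia).
have := addr_ge0 h1 h2; congr (_ <= _); ring.
Qed.

End Count.

Local Open Scope classical_set_scope.

(** * Consequences of a common continuous distribution function *)

Section EqualCdf.
Context {R : realType} {d : measure_display} {T : measurableType d}
  (P : probability T R).

(** Open right rays form a pi-system generating the Borel sets, and the distribution function
    measures their complements. *)
Lemma eq_cdf_distribution (X Y : {RV P >-> R}) :
  (forall t, cdf X t = cdf Y t) ->
  forall B, measurable B -> P (X @^-1` B) = P (Y @^-1` B).
Proof.
move=> XY B mB.
pose G : set (set R) := [set A | exists x, A = `]x, +oo[].
have hG : @measurable _ R = <<s G >> := RGenOInfty.measurableE R.
apply: (@measure_unique _ _ _ G (fun n => `](- n%:R), +oo[) hG _ _ _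
   (distribution P X) (distribution P Y)) => //.
- move=> _ _ [x ->] [y ->]; exists (Num.max x y).
  by apply/seteqP; split=> u /=; rewrite !in_itv /= !andbT gt_max => /andP.
- by move=> n; exists (- n%:R).
- apply/seteqP; split => // x _; exists (Num.truncn `|x|).+1 => //=.
  rewrite in_itv /= andbT ltrNl (le_lt_trans _ (truncnS_gt _)) //.
  by rewrite -normrN ler_norm.
- move=> _ [x ->]; rewrite -setCitvl.
  have compl (Z : {RV P >-> R}) :
      distribution P Z (~` `]-oo, x]) = (1 - cdf Z x)%E.
    exact: (probability_setC (distribution P Z)).
  by transitivity (1 - cdf X x)%E; [|rewrite XY]; rewrite -compl.
- by move=> n; rewrite (le_lt_trans (probability_le1 _ _)) ?ltry.
Qed.

(** For y < x the atom at x has mass at most F x - F y, which tends to 0 as y increases to x. *)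
Lemma continuous_cdf_atomless (X : {RV P >-> R}) (F : R -> R) :
  continuous F -> (forall t, cdf X t = (F t)%:E) ->
  forall x, P (X @^-1` [set x]) = 0%E.
Proof.
move=> cF XF x; apply/eqP; rewrite eq_le measure_ge0 andbT.
apply/lee_addgt0Pr => e e0; rewrite add0e.
have Fl : F y @[y --> x^'-] --> F x by apply: cvg_at_left_filter; exact: cF.
have /cvgrPdist_lt /(_ e e0) Fe := Fl.
near x^'- => y.
have yx : y < x by near: y; exact: nbhs_left_lt.
have ye : `|F x - F y| < e by near: y.
have : (P (X @^-1` [set x]) + P (X @^-1` `]-oo, y]) <= (F x)%:E)%E.
  rewrite -XF -measureU.
  - apply: le_measure; rewrite ?inE //.
    + by apply: measurableU; exact: measurable_funPTI.
    + exact: measurable_funPTI.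
    + move=> w /= [->|]; rewrite in_itv //= in_itv /= => /le_trans; apply.
      exact: ltW.
  - exact: measurable_funPTI.
  - exact: measurable_funPTI.
  - by apply/seteqP; split => // w /= [->]; rewrite in_itv /= leNgt yx.
rewrite -[P (X @^-1` `]-oo, y])]/(cdf X y) XF -leeBrDr // => /le_trans; apply.
by rewrite -EFinB lee_fin; apply: ltW; apply: le_lt_trans ye; exact: ler_norm.
Unshelve. all: by end_near. Qed.

End EqualCdf.

(** * Product sigma-algebra, exchangeability and absence of ties *)

Section Rectangles.
Context {R : realType} (I : finType).

Definition rectangles : set (set (I -> R)) :=
  [set A | exists2 B : I -> set R, (forall i, measurable (B i)) &
     A = [set z | forall i, B i (z i)]].

Local Notation RI := (g_sigma_algebraType rectangles).

Lemma measurable_coordinate (i : I) :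
  measurable_fun setT (fun z : RI => z i).
Proof.
move=> _ B mB; rewrite setTI; apply: sub_sigma_algebra.
exists (fun j => if j == i then B else setT).
  by move=> j; case: ifP.
apply/seteqP; split => z /= h; last by have := h i; rewrite eqxx.
by move=> j; case: eqP => // ->.
Qed.

Lemma measurable_coordinate_le (i j : I) :
  measurable [set z : RI | z i <= z j].
Proof.
have := measurable_fun_ler (measurable_coordinate i) (measurable_coordinate j).
move=> /(_ measurableT [set true]); rewrite setTI; exact.
Qed.

Lemma rectangles_setI : setI_closed rectangles.
Proof.
move=> _ _ [B mB ->] [C mC ->]; exists (fun i => B i `&` C i).
  by move=> i; exact: measurableI.
apply/seteqP; split => z /=; first by move=> [hB hC] i; split.
by move=> h; split=> i; have [] := h i.
Qed.

End Rectangles.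

Section IID.
Context {R : realType} {d : measure_display} {T : measurableType d}
  (P : probability T R) (I : finType) (Z : I -> {RV P >-> R}).
Hypothesis indep : mutually_independent Z.
Hypothesis ident : forall i j t, cdf (Z i) t = cdf (Z j) t.

Local Notation RI := (g_sigma_algebraType (@rectangles R I)).

Let joint (s : I -> I) (w : T) : RI := fun i => Z (s i) w.

Lemma measurable_joint s : measurable_fun setT (joint s).
Proof.
apply: (@measurability _ _ T RI setT (joint s) (@rectangles R I) erefl).
move=> _ [_ [B mB ->] <-]; rewrite setTI.
rewrite (_ : _ @^-1` _ = \bigcap_(i in [set` [set: I]%SET]) (Z (s i) @^-1` B i)).
  apply: fin_bigcap_measurable => // i _.
  exact: measurable_funPTI.
apply/seteqP; split => w /= h i; first by move=> _; exact: h.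
by apply: h; rewrite /= inE.
Qed.

Lemma independent_rectangle (s : I -> I) (i0 : I) (B : I -> set R) :
  injective s -> (forall i, measurable (B i)) ->
  P (joint s @^-1` [set z | forall i, B i (z i)]) =
  (\prod_(i in I) P (Z i0 @^-1` B i))%E.
Proof.
move=> s_inj mB.
pose t := invF s_inj.
have -> : joint s @^-1` [set z | forall i, B i (z i)] =
    \bigcap_(i in [set` [set: I]%SET]) (Z i @^-1` B (t i)).
  apply/seteqP; split => w /= h i.
    by move=> _; have := h (t i); rewrite /joint f_invF.
  by have /= := h (s i); rewrite /t invF_f; apply; rewrite inE.
rewrite (indep _ (fun i => mB (t i))).
rewrite (reindex s) /=; last by apply: onW_bij; exact: injF_bij.
apply: eq_big => [i|i _]; first by rewrite !inE.
by rewrite /t invF_f; apply: eq_cdf_distribution => // u; exact: ident.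
Qed.

(** On boxes both laws are the product of the common marginals, and boxes form a generating
    pi-system. The common marginal is named through an index [i0], hence the separate case of an
    empty [I]. *)
Lemma exchangeable (s : I -> I) (A : set RI) : injective s -> measurable A ->
  P (joint s @^-1` A) = P (joint id @^-1` A).
Proof.
move=> s_inj mA.
case: (pickP (mem I)) => [i0 _|I0]; last first.
  by congr (P _); apply/seteqP; split => w /=;
    congr (A _); apply/funext => i; have := I0 i.
pose f (s : I -> I) : {mfun T >-> RI} :=
  HB.pack (joint s) (isMeasurableFun.Build _ _ _ _ (joint s) (measurable_joint s)).
apply: (@measure_unique _ R RI (@rectangles R I) (fun=> setT) erefl
  (@rectangles_setI R I) _ _ (distribution P (f s)) (distribution P (f id))) => //.
- by move=> _; exists (fun=> setT) => //; apply/seteqP; split.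
- by apply/seteqP; split => // z _; exists 0%N.
- move=> _ [B mB ->]; transitivity (\prod_(i in I) P (Z i0 @^-1` B i))%E.
    exact: independent_rectangle.
  by apply/esym; apply: (@independent_rectangle id).
- by move=> n; rewrite (le_lt_trans (probability_le1 _ _)) ?ltry.
Qed.

(** By independence the law of the pair is a product measure, and each section of the diagonal is a
    single point, null for the atomless marginal. *)
Lemma ties_null (F : R -> R) : continuous F ->
  (forall i t, cdf (Z i) t = (F t)%:E) ->
  forall i j, i != j -> P [set w | Z i w = Z j w] = 0%E.
Proof.
move=> cF ZF i j ij.
have mp : measurable_fun setT (fun w => (Z i w, Z j w) : R * R).
  by apply: measurable_fun_pair.
pose pr : {mfun T >-> (R * R)%type} :=
  HB.pack (fun w => (Z i w, Z j w) : R * R) (isMeasurableFun.Build _ _ _ _ _ mp).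
pose diag := [set p : R * R | p.1 = p.2].
have mdiag : measurable diag.
  have := @measurable_fun_eqr _ _ _ setT _ _ (@measurable_fst _ _ R R) (@measurable_snd _ _ R R).
  move=> /(_ measurableT [set true]); rewrite setTI => /(_ _).
  rewrite (_ : _ @^-1` _ = diag); first exact.
  by apply/seteqP; split => p /= /eqP.
have -> : P [set w | Z i w = Z j w] = distribution P pr diag by [].
rewrite -(@product_measure_unique _ _ _ _ _ (distribution P (Z i)) (distribution P (Z j))) //.
  apply: integral0_eq => x _ /=.
  rewrite (_ : xsection diag x = [set x]); last first.
    by apply/seteqP; split => y; rewrite /xsection /= inE /diag /=.
  exact: (continuous_cdf_atomless cF (ZF j)).
move=> A B mA mB.
pose C l := if l == i then A else if l == j then B else setT.
have mC l : measurable (C l) by rewrite /C; case: ifP => // _; case: ifP.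
have := indep [set i; j]%SET mC.
rewrite big_setU1 ?inE //= big_set1 {2 3}/C !eqxx.
rewrite (eq_sym j i) (negbTE ij) => <-.
congr (P _); apply/seteqP; split => w /=.
  move=> [wA wB] l; rewrite /= !inE /C => /orP[/eqP->|/eqP->]; rewrite ?eqxx //.
  by rewrite (eq_sym j i) (negbTE ij).
move=> h; split.
  by have /= := h i; rewrite !inE eqxx /C eqxx; apply.
by have /= := h j; rewrite !inE eqxx orbT /C (eq_sym j i) (negbTE ij) eqxx; apply.
Qed.

End IID.

(** * Averaging over the relabelings of the pooled sample *)

(** [I] is listed twice, once with [A] in front and once with [B] in front; the bijection matches
    equal positions. *)
Lemma exists_bijection_imset (I : finType) (A B : {set I}) : #|A| = #|B| ->
  exists2 s : I -> I, injective s & (s @: A)%SET = B.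
Proof.
move=> cAB.
pose l (C : {set I}) := (enum C ++ enum (~: C))%SEQ.
have mem_l C (x : I) : x \in l C.
  by rewrite mem_cat !mem_enum inE orbN.
have uniq_l C : uniq (l C).
  rewrite cat_uniq !enum_uniq /= andbT; apply/hasPn => x.
  by rewrite !mem_enum inE.
have size_l C : size (l C) = #|I|.
  by rewrite size_cat -!cardE cardsC.
pose s x := nth x (l B) (index x (l A)).
have lt_i C x : (index x (l C) < #|I|)%N by rewrite -(size_l C) index_mem.
have sI : injective s.
  move=> x y; rewrite /s (set_nth_default x y) ?size_l // => /eqP.
  rewrite nth_uniq ?size_l // => /eqP e.
  by rewrite -[x](nth_index x (mem_l A x)) e nth_index.
exists s => //; apply/eqP; rewrite eqEcard card_imset // cAB leqnn andbT.
apply/fintype.subsetP => _ /imsetP[x xA ->].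
have ltx : (index x (l A) < #|B|)%N.
  by rewrite -cAB /l index_cat mem_enum xA cardE index_mem mem_enum.
by rewrite /s /l nth_cat -cardE ltx -mem_enum mem_nth // -cardE.
Qed.

Section Averaging.
Context {R : realType} {d : measure_display} {T : measurableType d}
  (P : probability T R) (I : finType) (Z : I -> {RV P >-> R}).
Hypothesis indep : mutually_independent Z.
Variable F : R -> R.
Hypothesis cF : continuous F.
Hypothesis ZF : forall i t, cdf (Z i) t = (F t)%:E.

Local Notation RI := (g_sigma_algebraType (@rectangles R I)).

Variable D : (I -> R) -> {set I} -> bool.
Hypothesis D_measurable : forall S, measurable [set z : RI | D z S].
Hypothesis D_imset : forall (s : I -> I) z S, injective s ->
  D (z \o s) S = D z (s @: S)%SET.

Let Zw w : I -> R := fun i => Z i w.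

Let event S := [set w | D (Zw w) S].

Let ident i j t : cdf (Z i) t = cdf (Z j) t.
Proof. by rewrite !ZF. Qed.

Let measurable_event S : measurable (event S).
Proof.
by have := measurable_joint Z id measurableT (D_measurable S); rewrite setTI.
Qed.

Let event_card (S S' : {set I}) : #|S| = #|S'| -> P (event S') = P (event S).
Proof.
move=> /exists_bijection_imset[s s_inj <-].
rewrite -[RHS](exchangeable indep ident s_inj (D_measurable S)).
congr (P _); apply/seteqP; split => w /=; rewrite /event /= -D_imset //.
Qed.

Let ae_injective : {ae P, forall w, injective (Zw w)}.
Proof.
have : {ae P, forall w, forall p : I * I, p.1 != p.2 -> Z p.1 w != Z p.2 w}.
  apply: filter_forall => -[i j].
  have [->|ij] := eqVneq i j; first exact: aeW.
  exists [set w | Z i w = Z j w]; split.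
  - have := @measurable_fun_eqr _ _ _ setT (Z i) (Z j) _ _ measurableT [set true].
    rewrite setTI (_ : _ @^-1` _ = [set w | Z i w = Z j w]).
      by apply.
    by apply/seteqP; split => p /= /eqP.
  - exact: (ties_null indep cF ZF ij).
  - move=> w /= h; apply/eqP; apply/negPn/negP => n; apply: h => _; exact: n.
apply: filterS => w h i j e; apply/eqP; apply/negPn/negP => n.
by have /= := h (i, j) n; rewrite -/(Zw w i) e eqxx.
Qed.

(** The random number of sets of size [#|S0|] satisfying [D] lies between [L] and [U] outside the
    null set of ties, and each of these sets contributes [P (event S0)] to its integral. *)
Lemma average_over_relabelings (S0 : {set I}) (L U : nat) :
  (forall z : I -> R, injective z ->
     (L <= #|[set S : {set I} | (#|S| == #|S0|) && D z S]%SET| <= U)%N) ->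
  (L%:R%:E <= 'C(#|I|, #|S0|)%:R%:E * P (event S0) <= U%:R%:E)%E.
Proof.
move=> LU.
pose slice := [set S : {set I} | #|S| == #|S0|]%SET.
pose f w : \bar R := (\sum_(S <- enum slice) (\1_(event S) w)%:E)%E.
have fE w : f w = #|[set S : {set I} | (#|S| == #|S0|) && D (Zw w) S]%SET|%:R%:E.
  rewrite /f big_enum /= sumEFin; congr _%:E; rewrite -[RHS]sumr_const.
  rewrite big_mkcond [RHS]big_mkcond /=; apply: eq_bigr => S _.
  rewrite !inE indicE; case: eqP => //= _.
  have -> : (w \in event S) = D (Zw w) S.
    by apply/idP/idP => [/set_mem|h]; last exact/mem_set.
  by case: (D _ _).
have mf1 S : measurable_fun setT (fun w => (\1_(event S) w)%:E : \bar R).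
  by apply/measurable_EFinP; exact: measurable_indic.
have mf : measurable_fun setT f by exact: emeasurable_sum.
have f0 w : (0 <= f w)%E by rewrite fE lee_fin.
have intf : (\int[P]_w f w)%E = ('C(#|I|, #|S0|)%:R%:E * P (event S0))%E.
  rewrite ge0_integral_sum // big_enum /= (eq_bigr (fun=> P (event S0))); last first.
    move=> S; rewrite inE => /eqP cS; rewrite integral_indic // setIT.
    by apply: event_card.
  by rewrite sumr_const card_draws mule_natl.
have intc (c : nat) : (\int[P]_w (c%:R%:E : \bar R))%E = c%:R%:E.
  by rewrite integral_cst //= probability_setT mule1.
rewrite -intf -(intc L) -[X in _ && (_ <= X)%E](intc U); apply/andP; split.
  apply: ae_ge0_le_integral => //.
  apply: filterS ae_injective => w /LU /andP[h _] _.
  by rewrite fE lee_fin ler_nat.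
apply: ae_ge0_le_integral => //.
apply: filterS ae_injective => w /LU /andP[_ h] _.
by rewrite fE lee_fin ler_nat.
Qed.

End Averaging.

(** * The Kolmogorov-Smirnov event in terms of ranks *)

Section Deviation.
Context {R : realType} (I : finType).

Definition at_most (z : I -> R) (t : R) : {set I} := [set i | z i <= t]%SET.

(** Testing at sample points keeps the condition finite; between them the excess is constant. *)
Definition deviates (k : nat) (z : I -> R) (S : {set I}) : bool :=
  [exists j, k%:Z <= `|excess S (at_most z (z j))|].

Lemma deviates_imset k (s : I -> I) z S : injective s ->
  deviates k (z \o s) S = deviates k z (s @: S)%SET.
Proof.
move=> s_inj.
have e j : excess S (at_most (z \o s) (z (s j))) =
    excess (s @: S)%SET (at_most z (z (s j))).
  have <- : (s @: at_most (z \o s) (z (s j)))%SET = at_most z (z (s j)).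
    apply/setP => i; apply/imsetP/idP => [[l]|]; rewrite !inE; first by move=> h ->.
    by move=> h; exists (invF s_inj i); rewrite ?inE /= f_invF.
  rewrite /excess -imsetI; last by move=> ? ? _ _; exact: s_inj.
  by rewrite !card_imset.
apply/existsP/existsP => -[j hj].
  by exists (s j); rewrite -e.
by exists (invF s_inj j); rewrite /= e f_invF.
Qed.

(** The condition depends only on the table of comparisons [z i <= z j], which takes finitely many
    values. *)
Lemma measurable_deviates k (S : {set I}) :
  measurable [set z : g_sigma_algebraType (@rectangles R I) | deviates k z S].
Proof.
pose B (p : {ffun I * I -> bool}) j : {set I} := [set i | p (i, j)]%SET.
pose Q p := [exists j, k%:Z <= `|excess S (B p j)|].
pose C (p : {ffun I * I -> bool}) : set (g_sigma_algebraType (@rectangles R I)) :=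
  \bigcap_(q in [set` [set: I * I]%SET]) [set z | (z q.1 <= z q.2) = p q].
have -> : [set z : g_sigma_algebraType (@rectangles R I) | deviates k z S] =
    \bigcup_(p in [set` [set p | Q p]%SET]) C p.
  have QE (p : {ffun I * I -> bool}) z : C p z -> Q p = deviates k z S.
    move=> Cz; apply: eq_existsb => j; congr (_ <= `|excess S _|).
    by apply/setP => i; rewrite !inE; rewrite -(Cz (i, j)) //= inE.
  apply/seteqP; split => z /=.
    move=> hz; pose p := [ffun q : I * I => z q.1 <= z q.2].
    have Cz : C p z by move=> q _ /=; rewrite ffunE.
    by exists p => //=; rewrite inE (QE _ _ Cz).
  by move=> [p /=]; rewrite inE => Qp Cz; rewrite -(QE _ _ Cz).
apply: fin_bigcup_measurable => // p _.
apply: fin_bigcap_measurable => // -[i j] _ /=.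
case: (p (i, j)).
  rewrite (_ : [set z | _] = [set z | z i <= z j]); first exact: measurable_coordinate_le.
  by apply/seteqP; split.
rewrite (_ : [set z | _] = ~` [set z | z i <= z j]).
  by apply: measurableC; exact: measurable_coordinate_le.
by apply/seteqP; split => z /=; [move=> -> | move=> /negP/negbTE].
Qed.

(** The points at most [z j] are those strictly below the successor of [j], and conversely with the
    predecessor. At the two ends, where there is no neighbour, the prefix is everything or empty and
    has excess 0 < k. *)
Lemma deviates_confined k (z : I -> R) (S : {set I}) :
  injective z -> (0 < k)%N -> #|I| = (#|S| + #|S|)%N ->
  deviates k z S = ~~ confined z k [set: I]%SET S.
Proof.
move=> z_inj k0 cI.
have exT : excess S [set: I]%SET = 0 by rewrite /excess finset.setIT cardsT cI; lia.
have ex0 : excess S finset.set0 = 0 by rewrite /excess finset.setI0 cards0.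
apply/idP/idP.
  move=> /existsP[j hj]; apply/negP => /andP[_ /forallP conf].
  have [l0 hl0|none] := pickP (fun l => z j < z l).
    case: (@arg_minP _ _ _ l0 (fun l => z j < z l) z hl0) => l jl lmin.
    have := conf l; rewrite inE finset.setTI /= (_ : below z l = at_most z (z j)) ?ltNge ?hj //.
    apply/setP => i; rewrite !inE; apply/idP/idP => [il|/le_lt_trans]; last exact.
    by rewrite leNgt; apply/negP => /lmin; rewrite leNgt il.
  move: hj; rewrite (_ : at_most _ _ = [set: I]%SET) ?exT ?normr0.
    by rewrite lez_nat leqNgt k0.
  by apply/setP => i; rewrite !inE leNgt none.
rewrite negb_and exT normr0 ltz_nat k0 /= negb_forall => /existsP[j].
rewrite inE finset.setTI /= -leNgt => hj.
have [l0 hl0|none] := pickP (fun l => z l < z j).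
  case: (@arg_maxP _ _ _ l0 (fun l => z l < z j) z hl0) => l jl lmax.
  apply/existsP; exists l; rewrite (_ : at_most _ _ = below z j) //.
  apply/setP => i; rewrite !inE; apply/idP/idP => [/le_lt_trans|]; first exact.
  exact: lmax.
have e : below z j = finset.set0 by apply/setP => i; rewrite !inE none.
by move: hj; rewrite e ex0 normr0 lez_nat leqNgt k0.
Qed.

End Deviation.

Section KSEvent.
Context {R : realType} (n : nat).
Hypothesis n_gt0 : (0 < n)%N.

Definition first_sample : {set 'I_n + 'I_n} :=
  [set s | if s is inl _ then true else false]%SET.

Lemma card_first_sample : #|first_sample| = n.
Proof.
rewrite (_ : first_sample = [set inl i | i in 'I_n])%SET.
  by rewrite card_imset ?card_ord //; move=> ? ? [].
apply/setP => -[i|i]; rewrite !inE; apply/esym.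
  by apply/imsetP; exists i.
by apply/negbTE/negP => /imsetP[].
Qed.

Lemma ecdf_excess (x y : 'I_n -> R) t :
  `|ecdf x t - ecdf y t| =
  (`|excess first_sample (at_most (pooled x y) t)|%N)%:R / n%:R.
Proof.
pose A := [set i | x i <= t]%SET; pose B := [set i | y i <= t]%SET.
have -> : excess first_sample (at_most (pooled x y) t) = #|A|%:Z - #|B|%:Z.
  have cA : #|first_sample :&: at_most (pooled x y) t|%SET = #|A|.
    rewrite -(card_imset (mem A) (f := @inl 'I_n 'I_n)); last by move=> ? ? [].
    apply: eq_card => -[i|i]; rewrite !inE /=.
      by apply/idP/imsetP => [h|[j jA [->]]]; [exists i; rewrite ?inE|rewrite !inE in jA].
    by apply/esym/negbTE/negP => /imsetP[].
  have cB : #|at_most (pooled x y) t :\: first_sample|%SET = #|B|.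
    rewrite -(card_imset (mem B) (f := @inr 'I_n 'I_n)); last by move=> ? ? [].
    apply: eq_card => -[i|i]; rewrite !inE /=.
      by apply/esym/negbTE/negP => /imsetP[].
    by apply/idP/imsetP => [h|[j jA [->]]]; [exists i; rewrite ?inE|rewrite !inE in jA].
  rewrite /excess cA -(cardsID first_sample (at_most _ _)) finset.setIC cA cB; lia.
rewrite /ecdf -mulrBl normrM [`|n%:R^-1|]ger0_norm ?invr_ge0 ?ler0n //.
congr (_ / _); rewrite natr_absz intr_norm rmorphB /=; congr `|_ - _|.
  by congr _%:R; apply: eq_card => i; rewrite !inE.
by congr _%:R; apply: eq_card => i; rewrite !inE.
Qed.

(** The second hypothesis makes [k] the index of the first lattice value at or above [M], which
    reduces a real threshold to an integer level. *)
Lemma KS_stat_ge (x y : 'I_n -> R) (M : R) (k : nat) : (0 < k)%N ->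
  (forall c : nat, (M <= KS_value R n c) = (k <= c)%N) ->
  (M <= KS_stat x y) = deviates k (pooled x y) first_sample.
Proof.
move=> k0 Mk.
pose z := pooled x y.
pose c t := `|excess first_sample (at_most z t)|%N.
have c_le t : (c t <= n + n)%N.
  have := max_card (at_most z t); rewrite card_sum card_ord.
  have := subset_leq_card (finset.subsetIr first_sample (at_most z t)).
  rewrite /c /excess; move: #|_ :&: _| #|at_most z t| => a b; lia.
(* The supremum in [KS_D] is attained, since it ranges over bounded natural numbers divided by
   [n]. *)
have [m [t0 ct0] m_max] : exists2 m, (exists t, c t = m) & forall t, (c t <= m)%N.
  have exP : exists m, `[< exists t, c t = m >] by exists (c 0); apply/asboolP; exists 0.
  have ubP m : `[< exists t, c t = m >] -> (m <= n + n)%N by move=> /asboolP[t <-].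
  case: (ex_maxnP exP ubP) => m /asboolP[t0 ct0] mmax; exists m; first by exists t0.
  by move=> t; apply: mmax; apply/asboolP; exists t.
have n0 : 0 < n%:R :> R by rewrite ltr0n.
have -> : KS_stat x y = KS_value R n m.
  have KSD : KS_D x y = m%:R / n%:R.
    apply/eqP; rewrite eq_le; apply/andP; split.
      apply: ge_sup; first by exists `|ecdf x 0 - ecdf y 0|, 0.
      move=> _ [t _ <-]; rewrite ecdf_excess ler_pM2r ?invr_gt0 // ler_nat.
      exact: m_max.
    apply: ub_le_sup.
      exists (m%:R / n%:R) => _ [t _ <-].
      by rewrite ecdf_excess ler_pM2r ?invr_gt0 // ler_nat m_max.
    by exists t0 => //; rewrite ecdf_excess -ct0.
  rewrite /KS_stat KSD /KS_value.
  have n2 : 0 < Num.sqrt (2 * n%:R) :> R by rewrite sqrtr_gt0 mulr_gt0.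
  have -> : Num.sqrt (n%:R / 2) = n%:R / Num.sqrt (2 * n%:R) :> R.
    apply: (mulIf (lt0r_neq0 n2)); rewrite divfK ?lt0r_neq0 //.
    rewrite -sqrtrM ?divr_ge0 ?ler0n // mulrA divfK ?pnatr_eq0 //.
    by rewrite -expr2 sqrtr_sqr ger0_norm ?ler0n.
  by rewrite mulrAC mulrCA mulfV ?mulr1 // lt0r_neq0.
rewrite Mk; apply/idP/existsP.
  (* Moving [t0] down to the largest sample point not above it leaves [at_most] unchanged. *)
  move=> km; have [l0 hl0|none] := pickP (fun l => z l <= t0).
    case: (@arg_maxP _ _ _ l0 (fun l => z l <= t0) z hl0) => l lt lmax; exists l.
    rewrite (_ : at_most _ _ = at_most z t0).
      by move: km; rewrite -ct0 /c; move: (excess _ _) => e; lia.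
    apply/setP => i; rewrite !inE; apply/idP/idP => [/le_trans|]; first exact.
    exact: lmax.
  have e : at_most z t0 = finset.set0 by apply/setP => i; rewrite !inE none.
  by move: km; rewrite -ct0 /c e /excess finset.setI0 cards0 leqNgt k0.
move=> [j hj]; apply: leq_trans (m_max (z j)); rewrite /c; move: hj; rewrite -/z.
by move: (excess _ _) => e; lia.
Qed.

End KSEvent.

(** * Bounds on the tail probability by binomial ratios *)

Section DeviationCount.
Context {R : realType} (I : finType) (n k : nat).
Hypothesis cardI : #|I| = (n + n)%N.
Hypothesis k_gt0 : (0 < k)%N.

Lemma binz_image (j : nat) :
  binz (n + n) (n%:Z + (j * k)%N%:Z) + binz (n + n) (n%:Z - (j * k)%N%:Z) =
  ('C(n + n, n + j * k).*2)%:Z.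
Proof.
rewrite -[X in _ + X]binz_sub.
have -> : (n + n)%N%:Z - (n%:Z - (j * k)%N%:Z) = n%:Z + (j * k)%N%:Z by lia.
by rewrite -PoszD /= -addnn PoszD.
Qed.

(** Subtracting the confined sets from all n-subsets turns the truncations J = 1, 2, 3 into an
    upper, a lower and an upper bound. Negative terms are moved across to stay in [nat]. *)
Lemma card_deviates (z : I -> R) : injective z ->
  let c := #|[set S : {set I} | (#|S| == n) && deviates k z S]%SET| in
  [/\ (c <= 'C(n + n, n + k).*2)%N,
      ('C(n + n, n + k).*2 <= c + 'C(n + n, n + 2 * k).*2)%N &
      (c + 'C(n + n, n + 2 * k).*2 <=
         'C(n + n, n + k).*2 + 'C(n + n, n + 3 * k).*2)%N].
Proof.
move=> z_inj c.
pose conf := confined_sets z k [set: I]%SET n%:Z.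
have cE : (c + #|conf| = 'C(n + n, n))%N.
  rewrite -cardI -card_draws -[RHS](cardsID [set S | deviates k z S]%SET).
  congr (_ + _)%N; apply: eq_card => S; rewrite !inE //.
  rewrite finset.subsetT eqz_nat /= andbC; case: eqVneq => [cS|_]; last by rewrite !andbF.
  by rewrite deviates_confined ?cS // negbK.
have bound J := @card_confined_bonf _ _ _ z z_inj k k_gt0 J [set: I]%SET n%:Z.
rewrite cardsT cardI in bound.
have {}bound J : 0 <= (-1) ^+ J * (bonf J k (n + n) n - #|conf|%:Z).
  by apply: bound; lia.
have [b1 b2 b3] := And3 (bound 1%N) (bound 2%N) (bound 3%N).
move: b1 b2 b3; rewrite /= !binz_image !exprS expr0 mul1n.
rewrite !mulr1 !mulN1r !opprK !mul1r -!addnn; clearbody c conf => b1 b2 b3.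
move: #|conf| cE b1 b2 b3 => e.
move: 'C(n + n, n) 'C(n + n, n + k) 'C(n + n, n + 2 * k) 'C(n + n, n + 3 * k)
  => a0 a1 a2 a3.
by split; lia.
Qed.

End DeviationCount.

Section H0Bounds.
Context {R : realType}.

Definition binomial_ratio (n k : nat) : R := 'C(n + n, n + k)%:R / 'C(n + n, n)%:R.
Local Notation rho := binomial_ratio.

Lemma H0_probability_bounds (n k : nat) (M : R) : (0 < n)%N -> (0 < k)%N ->
  (forall c : nat, (M <= KS_value R n c) = (k <= c)%N) ->
  under_H0 n M (fun p => exists2 r : R, p = r%:E &
    [/\ r <= 1, r <= 2 * rho n k, 2 * (rho n k - rho n (2 * k)) <= r &
        r <= 2 * (rho n k - rho n (2 * k) + rho n (3 * k))]).
Proof.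
move=> n0 k0 Mk d T P X Y [indep [F [cF XYF]]].
set E := [set w | _].
pose Z := pooled X Y.
have -> : E = [set w | deviates k (fun i => Z i w) (first_sample n)].
  apply/funext => w; rewrite /E /= (KS_stat_ge n0 _ _ k0 Mk).
  by congr (is_true (deviates k _ _)); apply/funext => -[].
have mE : measurable [set w | deviates k (fun i => Z i w) (first_sample n)].
  have := measurable_joint Z id measurableT (measurable_deviates k (first_sample n)).
  by rewrite setTI.
set p := P _.
have pfin : p \is a fin_num by apply: fin_num_measure.
have p1 : (p <= 1)%E by exact: probability_le1.
have cI : #|{: 'I_n + 'I_n}| = (n + n)%N by rewrite card_sum !card_ord.
have avg := average_over_relabelings indep cF XYF
  (fun S => measurable_deviates k S) (fun s z S => @deviates_imset _ _ k s z S)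
  (S0 := first_sample n).
rewrite card_first_sample cI in avg.
have C0 : 0 < 'C(n + n, n)%:R :> R by rewrite ltr0n bin_gt0 leq_addr.
set c0 := 'C(n + n, n) in avg C0 *.
set c1 := 'C(n + n, n + k).
set c2 := 'C(n + n, n + 2 * k).
set c3 := 'C(n + n, n + 3 * k).
(* Any configuration without ties will do: its count yields [c2.*2 <= c1.*2 + c3.*2], which turns
   the natural subtraction in the last bound into a real one. *)
have zex : injective (fun i : 'I_n + 'I_n => (enum_rank i : nat)%:R : R).
  move=> i j /eqP; rewrite eqr_nat => /eqP /val_inj; exact: enum_rank_inj.
have [_ _ c213] := card_deviates cI k0 zex.
have count (z : 'I_n + 'I_n -> R) (z_inj : injective z) :
    let c := #|[set S : {set 'I_n + 'I_n} | (#|S| == n) && deviates k z S]%SET| in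
    (c1.*2 - c2.*2 <= c <= c1.*2)%N /\ (0 <= c <= c1.*2 + c3.*2 - c2.*2)%N.
  move=> c; have [] := @card_deviates R _ n k cI k0 z z_inj.
  rewrite -/c -/c1 -/c2 -/c3 => h1 h2 h3; clearbody c; lia.
have /andP[] := avg _ _ (fun z z_inj => (count z z_inj).1).
have /andP[_] := avg _ _ (fun z z_inj => (count z z_inj).2).
rewrite -[P _]/p -(fineK pfin) -!EFinM !lee_fin => h3 h2 h1.
exists (fine p); first by [].
rewrite /binomial_ratio -/c0 -/c1 -/c2 -/c3.
split.
- by rewrite -lee_fin fineK.
- by rewrite mulrA ler_pdivlMr // mulrC (le_trans h1) // -mul2n natrM.
- rewrite -mulrBl mulrA ler_pdivrMr // [leRHS]mulrC (le_trans _ h2) //.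
  rewrite mulrBr -!natrM !mul2n lerBlDr -natrD ler_nat; lia.
- rewrite -mulrBl -mulrDl mulrA ler_pdivlMr // mulrC (le_trans h3) //.
  rewrite natrB ?natrD -?mul2n ?natrM; [lra|lia].
Qed.
End H0Bounds.

Local Close Scope classical_set_scope.

(** * Binomial ratios compared with Gaussian exponentials *)

Section Artanh.
Context {R : realType}.
Implicit Types u c : R.

(** The difference of logarithms is 2 artanh u. Its cubic Taylor coefficient is 2 / 3, and a larger
    [c] absorbs the rest of the series on a bounded range. *)
Definition artanh_gap c u : R := ln (1 + u) - ln (1 - u) - (2 * u + c * u ^+ 3).

Lemma artanh_gap0 c : artanh_gap c 0 = 0.
Proof. by rewrite /artanh_gap addr0 subr0 subrr expr0n !mulr0 addr0 subr0. Qed.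

Lemma is_derive_artanh_gap c u : `|u| < 1 ->
  is_derive u 1 (artanh_gap c) (u ^+ 2 * (2 / (1 - u ^+ 2) - 3 * c)).
Proof.
rewrite ltr_norml => /andP[u1 u2].
have h1 : 0 < 1 + u by lra.
have h2 : 0 < 1 - u by lra.
have d1 : is_derive u 1 (fun v => ln (1 + v)) (1 + u)^-1.
  have := @is_derive1_comp _ (@ln R) (fun v => 1 + v) u _ 1 (is_derive1_ln h1) _.
  by rewrite mulr1; apply; rewrite -[X in is_derive _ _ _ X]add0r; apply: is_deriveD.
have d2 : is_derive u 1 (fun v => ln (1 - v)) (- (1 - u)^-1).
  have := @is_derive1_comp _ (@ln R) (fun v => 1 - v) u _ (-1) (is_derive1_ln h2) _.
  by rewrite mulrN1; apply; rewrite -[X in is_derive _ _ _ X]add0r; apply: is_deriveD.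
have d3 : is_derive u 1 (fun v => 2 * v + c * v ^+ 3) (2 + 3 * c * u ^+ 2).
  apply: is_derive_eq.
  by rewrite /GRing.scale /=; ring.
have := is_deriveB (is_deriveB d1 d2) d3.
move=> h; apply: is_derive_eq h _.
by field; rewrite subr_eq0 !lt0r_neq0 // eq_sym lt_eqF //; nra.
Qed.

Lemma artanh_gap_ge0 u : 0 <= u -> u < 1 -> 0 <= artanh_gap (2 / 3) u.
Proof.
move=> u0 u1; rewrite -(artanh_gap0 (2 / 3)).
have bd v : v \in `[0, u] -> `|v| < 1.
  by rewrite in_itv /= => /andP[v0 vu]; rewrite ger0_norm // (le_lt_trans vu).
have bd' v : v \in `]0, u[ -> `|v| < 1.
  by move=> /subset_itv_oo_cc; exact: bd.
apply: (@ger0_derive1_le_cc _ (artanh_gap (2 / 3)) 0 u) => //.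
- by move=> v /bd' /(is_derive_artanh_gap (2 / 3)) [].
- move=> v vu; have [_ e] := is_derive_artanh_gap (2 / 3) (bd' _ vu).
  rewrite derive1E e mulr_ge0 ?sqr_ge0 // subr_ge0.
  have := bd' _ vu; rewrite ltr_norml => /andP[? ?].
  rewrite ler_pdivlMr; nra.
- apply: derivable_within_continuous => v /bd /(is_derive_artanh_gap (2 / 3)) [] //.
- by rewrite in_itv /= lexx ?u0.
- by rewrite in_itv /= lexx ?u0.
Qed.

(** The last hypothesis makes the factor [2 / (1 - v ^+ 2) - 3 * c] of the derivative nonpositive at
    v = u, hence on all of [0, u], since it increases with v. *)
Lemma artanh_gap_le0 c u : 0 <= u -> u < 1 -> 2 <= 3 * c * (1 - u ^+ 2) ->
  artanh_gap c u <= 0.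
Proof.
move=> u0 u1 cu; rewrite -(artanh_gap0 c).
have bd v : v \in `[0, u] -> `|v| < 1.
  by rewrite in_itv /= => /andP[v0 vu]; rewrite ger0_norm // (le_lt_trans vu).
have bd' v : v \in `]0, u[ -> `|v| < 1.
  by move=> /subset_itv_oo_cc; exact: bd.
apply: (@ler0_derive1_le_cc _ (artanh_gap c) 0 u) => //.
- by move=> v /bd' /(is_derive_artanh_gap c) [].
- move=> v vu; have [_ e] := is_derive_artanh_gap c (bd' _ vu).
  rewrite derive1E e mulr_ge0_le0 ?sqr_ge0 // subr_le0.
  have := bd' _ vu; rewrite ltr_norml => /andP[v1 v2].
  rewrite ler_pdivrMr; last by nra.
  move: vu; rewrite in_itv /= => /andP[v0 vu].
  have p : 0 < 1 - u ^+ 2 by nra.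
  have c0 : 0 <= c.
    have : 0 < 3 * c * (1 - u ^+ 2) by lra.
    by rewrite pmulr_lgt0 // => ?; lra.
  rewrite (le_trans cu) // ler_wpM2l ?mulr_ge0 //.
  by rewrite lerD2l lerN2; nra.
- apply: derivable_within_continuous => v /bd /(is_derive_artanh_gap c) [] //.
- by rewrite in_itv /= lexx ?u0.
- by rewrite in_itv /= lexx ?u0.
Qed.

Lemma artanh_gapE c u : `|u| < 1 ->
  (1 - u) / (1 + u) = expR (- (2 * u + c * u ^+ 3) - artanh_gap c u).
Proof.
rewrite ltr_norml => /andP[u1 u2].
have h1 : 0 < 1 + u by lra.
have h2 : 0 < 1 - u by lra.
have -> : - (2 * u + c * u ^+ 3) - artanh_gap c u = ln (1 - u) - ln (1 + u).
  by rewrite /artanh_gap; ring.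
by rewrite expRB !lnK ?posrE.
Qed.

End Artanh.

Section Rho.
Context {R : realType}.
Variable n : nat.
Local Notation rho := (@binomial_ratio R n).
Local Notation N := (2 * n%:R + 1 : R).

Lemma rho0 : rho 0 = 1.
Proof. by rewrite /binomial_ratio addn0 divff // pnatr_eq0 -lt0n bin_gt0 leq_addr. Qed.

Lemma rho_ge0 k : 0 <= rho k.
Proof. by rewrite divr_ge0 ?ler0n. Qed.

(** From [k = n] on both sides are 0, through natural subtraction, so the numerical rows may run
    past [n]. *)
Lemma rhoS k : rho k.+1 = rho k * (n - k)%:R / (n + k).+1%:R.
Proof.
have := mul_bin_left (n + n) (n + k).
rewrite subnDl => e.
have p0 : (n + k).+1%:R != 0 :> R by rewrite pnatr_eq0.
apply: (mulIf p0); rewrite divfK // /binomial_ratio mulrAC [RHS]mulrAC -!natrM.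
by rewrite addnS mulnC e mulnC.
Qed.

Lemma rho_eq0 k : (n < k)%N -> rho k = 0.
Proof. by move=> nk; rewrite /binomial_ratio bin_small ?mul0r // ltn_add2l. Qed.

Lemma rho_factor k : (k < n)%N ->
  (n - k)%:R / (n + k).+1%:R =
  (1 - (2 * k%:R + 1) / N) / (1 + (2 * k%:R + 1) / N).
Proof.
move=> kn; rewrite natrB ?(ltnW kn) // -addn1 !natrD.
have n0 : 0 <= n%:R :> R by [].
have k0 : 0 <= k%:R :> R by [].
by field; rewrite !lt0r_neq0 //; lra.
Qed.

(* With u_i = (2i + 1) / (2n + 1), this is minus the sum over i < k of
   2 u_i + c u_i^3: the odd numbers sum to k^2 and their cubes to k^2 (2 k^2 - 1). *)
Definition gauss_exponent (c : R) (k : nat) : R :=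
  - (2 * k%:R ^+ 2 / N + c * k%:R ^+ 2 * (2 * k%:R ^+ 2 - 1) / N ^+ 3).

Lemma gauss_exponentS c k : gauss_exponent c k.+1 = gauss_exponent c k
  - (2 * ((2 * k%:R + 1) / N) + c * ((2 * k%:R + 1) / N) ^+ 3).
Proof.
rewrite /gauss_exponent -addn1 natrD.
have n0 : 0 <= n%:R :> R by [].
by field; rewrite lt0r_neq0 //; lra.
Qed.

Lemma step_ratio_bounds k : (k < n)%N ->
  0 <= (2 * k%:R + 1) / N :> R /\ (2 * k%:R + 1) / N < 1 :> R.
Proof.
move=> kn; have k0 : 0 <= k%:R :> R by [].
have kn' : k%:R + 1 <= n%:R :> R by rewrite natr1 ler_nat.
split; first by rewrite divr_ge0 //; lra.
by rewrite ltr_pdivrMr; lra.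
Qed.

Lemma rho_le_gauss k : rho k <= expR (gauss_exponent (2 / 3) k).
Proof.
elim: k => [|k IH].
  by rewrite rho0 /gauss_exponent expr0n /= !(mulr0, mul0r) addr0 oppr0 expR0.
have [nk|kn] := leqP n k; first by rewrite rho_eq0 ?expR_ge0.
have [u0 u1] := step_ratio_bounds kn.
have u1' : `|(2 * k%:R + 1) / N| < 1 :> R by rewrite ger0_norm.
rewrite rhoS -mulrA rho_factor // (artanh_gapE (2 / 3)) // gauss_exponentS.
rewrite expRD ler_pM ?rho_ge0 ?expR_ge0 // ler_expR.
by have := artanh_gap_ge0 u0 u1; lra.
Qed.

(** The ratio in the hypothesis is u_(k-1), the largest one in the product, so the condition passes
    down the induction. At k = 0 it is negative, but only its square matters. *)
Lemma rho_ge_gauss c k : (k <= n)%N ->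
  2 <= 3 * c * (1 - ((2 * k%:R - 1) / N) ^+ 2) ->
  expR (gauss_exponent c k) <= rho k.
Proof.
elim: k => [|k IH] kn hc.
  by rewrite rho0 /gauss_exponent expr0n /= !(mulr0, mul0r) addr0 oppr0 expR0.
have [u0 u1] := step_ratio_bounds kn.
have u1' : `|(2 * k%:R + 1) / N| < 1 :> R by rewrite ger0_norm.
have e : (2 * k.+1%:R - 1) / N = (2 * k%:R + 1) / N :> R.
  by rewrite -natr1; congr (_ / _); ring.
rewrite e in hc.
rewrite rhoS -mulrA rho_factor // (artanh_gapE c) // gauss_exponentS.
rewrite expRD ler_pM ?expR_ge0 //; last first.
  by rewrite ler_expR; have := artanh_gap_le0 u0 u1 hc; lra.
apply: IH; first exact: ltnW.
set w := (2 * k%:R - 1) / N; set u := (2 * k%:R + 1) / N in u0 u1 hc u1' e *.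
have N0 : 0 < N by have : 0 <= n%:R :> R by []; lra.
have k0 : 0 <= k%:R :> R by [].
have wu : w ^+ 2 <= u ^+ 2.
  rewrite /w /u !expr_div_n ler_pM2r ?invr_gt0 ?exprn_gt0 //; nra.
have p : 0 < 1 - u ^+ 2 by nra.
have c0 : 0 <= c.
  have : 0 < 3 * c * (1 - u ^+ 2) by lra.
  by rewrite pmulr_lgt0 // => ?; lra.
by rewrite (le_trans hc) // ler_wpM2l ?mulr_ge0 //; lra.
Qed.

Lemma rho_le_expR_tail k : (2 <= n)%N -> (3 * n + 4 <= k ^ 2)%N ->
  rho k <= expR (- (k%:R ^+ 2 / n%:R)).
Proof.
move=> n2 nk; apply: (le_trans (rho_le_gauss k)); rewrite ler_expR /gauss_exponent.
have hn : 2 <= n%:R :> R by rewrite ler_nat.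
have hy : 3 * n%:R + 4 <= k%:R ^+ 2 :> R.
  by rewrite -natrX -natrM -natrD ler_nat.
move: (k%:R ^+ 2) (n%:R) hn hy => y v hv hy.
rewrite lerN2 -subr_ge0.
(* For y >= 3 v + 4 the bracket is at least 2 v - 3, positive when v >= 2; 4 is the least integer
   offset that makes the linear term positive. *)
have -> : 2 * y / (2 * v + 1) + 2 / 3 * y * (2 * y - 1) / (2 * v + 1) ^+ 3 - y / v =
    y * (2 * v * (2 * y - 1) - 3 * (2 * v + 1) ^+ 2) / (3 * v * (2 * v + 1) ^+ 3).
  by field; rewrite !lt0r_neq0 //; lra.
apply: divr_ge0; last by rewrite !mulr_ge0 ?exprn_ge0 //; lra.
apply: mulr_ge0; nra.
Qed.

(** With [c = expR x0] the left side is the tangent of [expR (- x)] at [x0]. A rational upper bound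
    [c] lowers it where it is positive; elsewhere the inequality is trivial. *)
Lemma expR_neg_tangent (x0 x c : R) : expR x0 <= c ->
  (1 + x0 - x) / c <= expR (- x).
Proof.
move=> h; have c0 : 0 < c by apply: lt_le_trans h; exact: expR_gt0.
have [hx|hx] := lerP 0 (1 + x0 - x); last first.
  by rewrite (@le_trans _ _ 0) ?expR_ge0 // ltW // pmulr_llt0 ?invr_gt0.
have e : expR (- x) = expR (x0 - x) * (expR x0)^-1.
  by rewrite -expRN -expRD; congr expR; ring.
have h1 : 1 + x0 - x <= expR (x0 - x) by have := expR_ge1Dx (x0 - x); lra.
have h2 : c^-1 <= (expR x0)^-1 by rewrite lef_pV2 ?posrE ?expR_gt0.
by rewrite e ler_pM // invr_ge0 ltW.
Qed.

(* With x = k^2 / n, it is enough that the excess [a] in the exponent of rho_k is at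
   most a fixed multiple of exp(- 3 x), which is bounded below by its tangent at
   x = 17/6. *)
Lemma rho_sum_le_expR k : expR (17 / 2) <= 499 * 10 :> R -> (700 <= n)%N ->
  (69 * n < 100 * k ^ 2)%N -> (k ^ 2 < 3 * n + 4)%N ->
  rho k - rho (2 * k) + rho (3 * k) <= expR (- (k%:R ^+ 2 / n%:R)).
Proof.
move=> he n700 nk kn.
have hn : 7 * 100 <= n%:R :> R by rewrite -natrM ler_nat.
have hy1 : 69 * n%:R <= 100 * k%:R ^+ 2 :> R.
  by rewrite -natrX -!natrM ler_nat ltnW.
have hy2 : k%:R ^+ 2 <= 3 * n%:R + 4 :> R.
  by rewrite -natrX -natrM -natrD ler_nat ltnW.
set x := k%:R ^+ 2 / n%:R.
have x1 : 69 / 100 <= x by rewrite ler_pdivlMr; lra.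
have x2 : x <= 301 / 100 by rewrite ler_pdivrMr; lra.
(* The first-order excess has 1 in place of [401 / 400]; the difference absorbs the higher orders in
   1 / n. *)
pose a := x / (2 * n%:R) * (401 / 400 - x / 3).
have h1 : rho k <= expR (- x + a).
  apply: (le_trans (rho_le_gauss k)); rewrite ler_expR /gauss_exponent /a /x.
  move: (k%:R ^+ 2) (n%:R) hn hy1 hy2 => y v hv hy1 hy2.
  rewrite -subr_ge0.
  have -> : - (y / v) + y / v / (2 * v) * (401 / 400 - y / v / 3) -
     - (2 * y / (2 * v + 1) + 2 / 3 * y * (2 * y - 1) / (2 * v + 1) ^+ 3) =
     y * (1203 / 400 * v * (2 * v + 1) ^+ 3 - 6 * v ^+ 2 * (2 * v + 1) ^+ 2
       - 4 * v ^+ 3 - y * (12 * v ^+ 2 + 6 * v + 1)) / (6 * v ^+ 3 * (2 * v + 1) ^+ 3).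
    by field; rewrite !lt0r_neq0 //; lra.
  apply: divr_ge0; last by rewrite !mulr_ge0 ?exprn_ge0 //; lra.
  apply: mulr_ge0; first by lra.
  have : y * (12 * v ^+ 2 + 6 * v + 1) <= (3 * v + 4) * (12 * v ^+ 2 + 6 * v + 1).
    by apply: ler_wpM2r => //; nra.
  have : 7 * 100 * v ^+ 3 <= v ^+ 4 by rewrite [v ^+ 4]exprS ler_wpM2r // exprn_ge0; lra.
  have : 7 * 100 * v ^+ 2 <= v ^+ 3 by rewrite [v ^+ 3]exprS ler_wpM2r // exprn_ge0; lra.
  have : 7 * 100 * v <= v ^+ 2 by rewrite expr2 ler_wpM2r //; lra.
  nra.
have h2 : expR (- (4 * x) - 4 / 100) <= rho (2 * k).
  have k2n : (2 * k <= n)%N by nia.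
  (* Here u^2 <= 1 / 21, and 3 (7 / 10) (1 - 1 / 21) is exactly 2. *)
  apply: (le_trans _ (@rho_ge_gauss (7 / 10) _ k2n _)).
    rewrite ler_expR /gauss_exponent natrM exprMn /x.
    move: (k%:R ^+ 2) (n%:R) hn hy1 hy2 => y v hv hy1 hy2.
    have -> : 2%:R ^+ 2 * y = 4 * y by rewrite -natrX.
    have p1 : 8 * y / (2 * v + 1) <= 4 * (y / v).
      have -> : 4 * (y / v) = 8 * y / (2 * v) by field; lra.
      by rewrite ler_wpM2l ?lef_pV2 ?posrE //; lra.
    have p2 : 7 / 10 * (4 * y) * (2 * (4 * y) - 1) / (2 * v + 1) ^+ 3 <= 4 / 100.
      have N0 : 0 < 2 * v + 1 by lra.
      rewrite ler_pdivrMr ?exprn_gt0 //.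
      have : y * (8 * y - 1) <= (3 * v + 4) * (8 * (3 * v + 4) - 1).
        by apply: ler_pM; lra.
      have : 7 * 100 * v ^+ 2 <= v ^+ 3 by rewrite [v ^+ 3]exprS ler_wpM2r // exprn_ge0; lra.
      have : 7 * 100 * v <= v ^+ 2 by rewrite expr2 ler_wpM2r //; lra.
      nra.
    lra.
  have kk : (4 * k%:R) ^+ 2 <= 48 * n%:R + 64 :> R by rewrite exprMn; lra.
  have k1 : 1 <= k%:R :> R by rewrite ler1n; move: nk; case: (k) => //; lia.
  have -> : 2 * (2 * k)%:R - 1 = 4 * k%:R - 1 :> R by rewrite natrM; ring.
  rewrite expr_div_n.
  have : (4 * k%:R - 1) ^+ 2 / N ^+ 2 <= 1 / 21.
    have N0 : 0 < N by lra.
    rewrite ler_pdivrMr ?exprn_gt0 //.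
    have : (4 * k%:R - 1) ^+ 2 <= (4 * k%:R) ^+ 2 :> R.
      by rewrite -subr_ge0; rewrite (_ : _ - _ = 8 * k%:R - 1); [lra|ring].
    have : 7 * 100 * n%:R <= n%:R ^+ 2 :> R by rewrite expr2 ler_wpM2r //; lra.
    nra.
  lra.
have h3 : rho (3 * k) <= expR (- (9 * x) + 2 / 100).
  apply: (le_trans (rho_le_gauss _)); rewrite ler_expR /gauss_exponent natrM exprMn /x.
  move: (k%:R ^+ 2) (n%:R) hn hy1 hy2 => y v hv hy1 hy2.
  have -> : 3%:R ^+ 2 * y = 9 * y by rewrite -natrX.
  have p1 : 9 * (y / v) - 2 * (9 * y) / (2 * v + 1) <= 2 / 100.
    have -> : 9 * (y / v) - 2 * (9 * y) / (2 * v + 1) = 9 * y / (v * (2 * v + 1)).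
      by field; rewrite !lt0r_neq0 //; lra.
    rewrite ler_pdivrMr ?mulr_gt0 //; try lra.
    have : 7 * 100 * v <= v ^+ 2 by rewrite expr2 ler_wpM2r //; lra.
    nra.
  have p2 : 0 <= 2 / 3 * (9 * y) * (2 * (9 * y) - 1) / (2 * v + 1) ^+ 3.
    by rewrite !mulr_ge0 ?invr_ge0 ?exprn_ge0 //; lra.
  lra.
have h4 : expR (- (9 * x) + 2 / 100) <= expR (- (4 * x)) * (9 / 100).
  have -> : - (9 * x) + 2 / 100 = - (4 * x) + (- (5 * x) + 2 / 100) by ring.
  rewrite expRD ler_wpM2l ?expR_ge0 //.
  have -> : - (5 * x) + 2 / 100 = 8%:R * - (5 / 8 * x - 1 / 400).
    by field.
  rewrite expRM_natl.
  have w : expR (- (5 / 8 * x - 1 / 400)) <= 7 / 10.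
    have h : 10 / 7 <= expR (5 / 8 * x - 1 / 400).
      by have := expR_ge1Dx (5 / 8 * x - 1 / 400); lra.
    by rewrite expRN -[7 / 10]invrK lef_pV2 ?posrE ?invr_gt0 ?expR_gt0 ?invf_div //; lra.
  apply: (@le_trans _ _ ((7 / 10) ^+ 8)); first by rewrite ler_pXn2r ?nnegrE ?expR_ge0 //; lra.
  lra.
have h5 : expR (- (4 * x)) * (96 / 100) <= expR (- (4 * x) - 4 / 100).
  by rewrite expRD ler_wpM2l ?expR_ge0 //; have := expR_ge1Dx (- (4 / 100) : R); lra.
have a1 : a <= 1 / 1000.
  rewrite /a mulrAC ler_pdivrMr; [nra|lra].
(* [87 / 100] is [96 / 100 - 9 / 100]: the lower bound for rho_2k less the upper bound for rho_3k,
   in units of [expR (- (4 * x))]. *)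
have h6 : expR a <= 1 + 87 / 100 * expR (- (3 * x)).
  have [a0|a0] := lerP a 0.
    rewrite (@le_trans _ _ 1) ?expR_le1 // lerDl mulr_ge0 ?expR_ge0 //; lra.
  have ea : expR a <= 1 + 501 / 500 * a.
    have : expR (- a) >= 1 - a by exact: expR_ge1Dx.
    rewrite expRN => h.
    have : expR a <= (1 - a)^-1.
      by rewrite -[expR a]invrK lef_pV2 ?posrE ?invr_gt0 ?expR_gt0 //; lra.
    move=> /le_trans; apply; rewrite -[(1 - a)^-1]mul1r ler_pdivrMr; nra.
  apply: (le_trans ea); rewrite lerD2l.
  apply: le_trans (ler_wpM2l _ (expR_neg_tangent (3 * x) he)); last by lra.
  have : a <= x * (401 / 400 - x / 3) / (14 * 100).
    rewrite /a mulrAC; apply: ler_wpM2l; last by rewrite lef_pV2 ?posrE; lra.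
    move: a0; rewrite /a mulrAC pmulr_lgt0 ?invr_gt0; [exact: ltW|lra].
  (* The tangent minus the bound on [a] is a quadratic in x that is smallest near 13 / 5, and still
     positive there. *)
  have := sqr_ge0 (x - 13 / 5); lra.
have e4 : expR (- (4 * x)) = expR (- x) * expR (- (3 * x)).
  by rewrite -expRD; congr expR; ring.
have e1 : expR (- x + a) = expR (- x) * expR a by rewrite expRD.
have p : 0 <= expR (- x) by exact: expR_ge0.
rewrite e4 in h4 h5; rewrite e1 in h1.
have := ler_wpM2l p h6; lra.
Qed.

End Rho.

(** * Taylor bounds for the exponential *)

Section ExpTaylor.
Context {R : realType}.
Implicit Types x : R.

Lemma expR_ge_taylor x m : 0 <= x -> series (exp_coeff x) m <= expR x.
Proof.
move=> x0; apply: nondecreasing_cvgn_le.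
  by apply: nondecreasing_series => i _ _; exact: exp_coeff_ge0.
exact: is_cvg_series_exp_coeff.
Qed.

(** From index [m] on, each term is at most half the previous one, so a partial sum plus twice the
    next term can only decrease. *)
Lemma expR_le_taylor x m : 0 <= x -> 2 * x <= m.+1%:R ->
  expR x <= series (exp_coeff x) m + 2 * exp_coeff x m.
Proof.
move=> x0 xm; apply: limr_le; first exact: is_cvg_series_exp_coeff.
pose U j := series (exp_coeff x) j + 2 * exp_coeff x j.
have Ud j : U (m + j)%N <= U m.
  elim: j => [|j IH]; first by rewrite addn0.
  apply: le_trans IH; rewrite addnS /U seriesSr -addrA lerD2l.
  suff : 2 * exp_coeff x (m + j).+1 <= exp_coeff x (m + j) by lra.
  have -> : exp_coeff x (m + j).+1 = exp_coeff x (m + j) * (x / (m + j).+1%:R).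
    rewrite !exp_coeffE factS natrM exprSr /= invfM; ring.
  rewrite mulrCA ler_piMr ?exp_coeff_ge0 // mulrA ler_pdivrMr ?ltr0n // mul1r.
  by rewrite (le_trans xm) // ler_nat ltnS leq_addr.
exists m => // j /= mj; apply: le_trans (Ud (j - m)%N).
by rewrite subnKC // /U lerDl mulr_ge0 ?exp_coeff_ge0.
Qed.

End ExpTaylor.

(** * Fixed-point algorithms *)

Section FixedPointChecks.
Variable bits : N.

(* The natural number [a] stands for [a / 2 ^ bits].  The argument [u] selects the
   rounding direction: 1 rounds up, 0 rounds down. *)
Definition fixed_one : N := N.shiftl 1 bits.
Definition muldiv (u a b c : N) : N := (a * b / c + u)%num.
Definition fixed_mul (u a b : N) : N := (N.shiftr (a * b) bits + u)%num.

(* Taylor approximation of [expR n^-1]. *)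
Fixpoint exp_inv (u n : N) (fuel : nat) (i t s : N) : N :=
  match fuel with
  | O => (s + 2 * u * t)%num
  | S f => exp_inv u n f (i + 1)%num (muldiv u t 1 (n * (i + 1))%num) (s + t)%num
  end.

Definition rho_step (u n k a : N) : N := muldiv u a (n - k) (n + k + 1).

(* At step [k], [a], [b], [c] approximate the binomial ratios at [k], [2 k], [3 k],
   and [e], [g] approximate [expR (k ^ 2 / n)] and [expR ((2 k + 1) / n)]. *)
Fixpoint upper_row (n cn cd g2 : N) (fuel : nat) (k a b c e g : N) : bool :=
  match fuel with
  | O => false
  | S f =>
    if (3 * n + 4 <=? k * k)%num then true else
    if (if 69 * n <? 100 * (k * k)
        then cd * (a + c) * e <=? cn * (fixed_one * fixed_one) + cd * b * e
        else true)%num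
    then upper_row n cn cd g2 f (k + 1)%num (rho_step 1 n k a)
      (rho_step 0 n (2 * k + 1) (rho_step 0 n (2 * k) b))
      (rho_step 1 n (3 * k + 2) (rho_step 1 n (3 * k + 1) (rho_step 1 n (3 * k) c)))
      (fixed_mul 1 e g) (fixed_mul 1 g g2)
    else false
  end.

(** Fuel 50 suffices for n < 700, where k^2 reaches 3 n + 4 by k = 46. Exhausted fuel returns
    [false], so a success is meaningful whatever the fuel. *)
Definition upper_check (n cn cd : N) : bool :=
  let g := exp_inv 1 n 10 0 fixed_one 0 in
  upper_row n cn cd (fixed_mul 1 g g) 50 0 fixed_one fixed_one fixed_one fixed_one g.

Fixpoint lower_row (n g2 : N) (fuel : nat) (k a b e g : N) : bool :=
  match fuel with
  | O => false
  | S f =>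
    if (fixed_one * fixed_one + b * e <? a * e)%num then true else
    lower_row n g2 f (k + 1)%num (rho_step 0 n k a)
      (rho_step 1 n (2 * k + 1) (rho_step 1 n (2 * k) b))
      (fixed_mul 0 e g) (fixed_mul 0 g g2)
  end.

Definition lower_check (n : N) : bool :=
  let g := exp_inv 0 n 10 0 fixed_one 0 in
  lower_row n (fixed_mul 0 g g) 50 0 fixed_one fixed_one fixed_one g.

Lemma upper_rowS n cn cd g2 f k a b c e g :
  upper_row n cn cd g2 f.+1 k a b c e g =
    (if (3 * n + 4 <=? k * k)%num then true else
    if (if 69 * n <? 100 * (k * k)
        then cd * (a + c) * e <=? cn * (fixed_one * fixed_one) + cd * b * e
        else true)%num
    then upper_row n cn cd g2 f (k + 1)%num (rho_step 1 n k a)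
      (rho_step 0 n (2 * k + 1) (rho_step 0 n (2 * k) b))
      (rho_step 1 n (3 * k + 2) (rho_step 1 n (3 * k + 1) (rho_step 1 n (3 * k) c)))
      (fixed_mul 1 e g) (fixed_mul 1 g g2)
    else false).
Proof. by []. Qed.

Lemma lower_rowS n g2 f k a b e g :
  lower_row n g2 f.+1 k a b e g =
    (if (fixed_one * fixed_one + b * e <? a * e)%num then true else
    lower_row n g2 f (k + 1)%num (rho_step 0 n k a)
      (rho_step 1 n (2 * k + 1) (rho_step 1 n (2 * k) b))
      (fixed_mul 0 e g) (fixed_mul 0 g g2)).
Proof. by []. Qed.

End FixedPointChecks.

Fixpoint forall_range (p : N -> bool) (m : nat) (n : N) : bool :=
  match m with
  | O => true
  | S m' => if p n then forall_range p m' (n + 1)%num else false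
  end.

Lemma forall_rangeP p m n i : forall_range p m n ->
  (N.to_nat n <= i < N.to_nat n + m)%N -> p (N.of_nat i).
Proof.
elim: m n => [|m IH] n /=; first by lia.
case: ifP => // pn /IH h hi; have [e|ne] := eqVneq (N.to_nat n) i.
  by rewrite -e N2Nat.id.
by apply: h; lia.
Qed.

(** * Soundness of the fixed-point algorithms *)

Section FixedPoint.
Context {R : realType} (bits : N).
Local Notation scale := (fixed_one bits).
Local Notation fixmul := (fixed_mul bits).
Implicit Types (a b c : N) (r q : R).

Definition natval a : R := (N.to_nat a)%:R.

Lemma natvalD a b : natval (a + b)%num = natval a + natval b.
Proof. by rewrite /natval N2Nat.inj_add natrD. Qed.

Lemma natvalM a b : natval (a * b)%num = natval a * natval b.
Proof. by rewrite /natval N2Nat.inj_mul natrM. Qed.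

Lemma natval_ge0 a : 0 <= natval a.
Proof. exact: ler0n. Qed.

Lemma natval_le a b : (a <= b)%num -> natval a <= natval b.
Proof. by move=> ab; rewrite ler_nat; lia. Qed.

Lemma natval_lt a b : (a < b)%num -> natval a < natval b.
Proof. by move=> ab; rewrite ltr_nat; lia. Qed.

Lemma natval_gt0 a : (0 < a)%num -> 0 < natval a.
Proof. by move=> a0; rewrite ltr0n; lia. Qed.

Lemma muldiv_up a b c : (0 < c)%num ->
  natval a * natval b / natval c <= natval (muldiv 1 a b c).
Proof.
move=> c0; have c0' := natval_gt0 c0.
rewrite ler_pdivrMr // -!natvalM; apply: natval_le; rewrite /muldiv.
have := N.mul_succ_div_gt (a * b) c; lia.
Qed.

Lemma muldiv_down a b c : (0 < c)%num ->
  natval (muldiv 0 a b c) <= natval a * natval b / natval c.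
Proof.
move=> c0; have c0' := natval_gt0 c0.
rewrite ler_pdivlMr // -!natvalM; apply: natval_le; rewrite /muldiv.
have := N.mul_div_le (a * b) c; lia.
Qed.

Lemma fixmulE u a b : fixmul u a b = muldiv u a b scale.
Proof. by rewrite /fixed_mul /fixed_one N.shiftr_div_pow2 N.shiftl_1_l. Qed.

Local Notation sR := (natval scale : R).

Lemma scale_gt0 : 0 < sR.
Proof. by apply: natval_gt0; rewrite /fixed_one N.shiftl_1_l; lia. Qed.

Definition above a r := r * sR <= natval a.
Definition under a r := natval a <= r * sR.

Lemma above_fixmul a b r q : 0 <= r -> 0 <= q ->
  above a r -> above b q -> above (fixmul 1 a b) (r * q).
Proof.
move=> r0 q0 ha hb; have s0 := scale_gt0.
rewrite /above fixmulE; apply: le_trans (muldiv_up a b _) => //.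
rewrite ler_pdivlMr //.
have := ler_pM (mulr_ge0 r0 (ltW s0)) (mulr_ge0 q0 (ltW s0)) ha hb.
by rewrite mulrACA mulrA.
Qed.

Lemma under_fixmul a b r q : under a r -> under b q ->
  under (fixmul 0 a b) (r * q).
Proof.
move=> ha hb; have s0 := scale_gt0.
rewrite /under fixmulE; apply: le_trans (muldiv_down a b _) _ => //.
rewrite ler_pdivrMr //.
have := ler_pM (natval_ge0 _) (natval_ge0 _) ha hb.
by rewrite mulrACA mulrA.
Qed.

Lemma above_muldiv a b c r : (0 < c)%num -> above a r ->
  above (muldiv 1 a b c) (r * natval b / natval c).
Proof.
move=> c0 ha; apply: le_trans (muldiv_up a b c0).
have -> : r * natval b / natval c * sR = (r * sR) * (natval b / natval c).
  by rewrite -[r * _ / _]mulrA mulrAC.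
by rewrite -[leRHS]mulrA ler_wpM2r // divr_ge0 ?natval_ge0.
Qed.

Lemma under_muldiv a b c r : (0 < c)%num -> under a r ->
  under (muldiv 0 a b c) (r * natval b / natval c).
Proof.
move=> c0 ha; apply: le_trans (muldiv_down a b c0) _.
have -> : r * natval b / natval c * sR = (r * sR) * (natval b / natval c).
  by rewrite -[r * _ / _]mulrA mulrAC.
by rewrite -[leLHS]mulrA ler_wpM2r // divr_ge0 ?natval_ge0.
Qed.

Lemma natval1 : natval 1%num = 1 :> R.
Proof. by []. Qed.

Lemma aboveD a b r q : above a r -> above b q -> above (a + b)%num (r + q).
Proof. by move=> ha hb; rewrite /above natvalD mulrDl lerD. Qed.

Lemma underD a b r q : under a r -> under b q -> under (a + b)%num (r + q).
Proof. by move=> ha hb; rewrite /under natvalD mulrDl lerD. Qed.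

Lemma exp_inv0 u n i t s : exp_inv u n 0 i t s = (s + 2 * u * t)%num.
Proof. by []. Qed.

Lemma exp_invS u n f i t s : exp_inv u n f.+1 i t s =
  exp_inv u n f (i + 1)%num (muldiv u t 1 (n * (i + 1))%num) (s + t)%num.
Proof. by []. Qed.

Lemma exp_coeff_inv_succ n i :
  exp_coeff (natval n)^-1 (N.to_nat i) * natval 1 / natval (n * (i + 1))%num =
  exp_coeff (natval n)^-1 (N.to_nat (i + 1)%num) :> R.
Proof.
have i1 : N.to_nat (i + 1)%num = (N.to_nat i).+1 by lia.
have v1 : natval (i + 1)%num = (N.to_nat i).+1%:R by rewrite -i1.
rewrite natval1 mulr1 natvalM v1 !exp_coeffE /= i1 factS natrM exprSr.
rewrite !invfM; move: (_ ^+ N.to_nat i) (_`!%:R^-1) (_.+1%:R^-1) => p f q.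
by move: (natval n)^-1 => y; ring.
Qed.

Lemma above_exp_inv n fuel i t s : (0 < n)%num ->
  above t (exp_coeff (natval n)^-1 (N.to_nat i)) ->
  above s (series (exp_coeff (natval n)^-1) (N.to_nat i)) ->
  above (exp_inv 1 n fuel i t s)
    (series (exp_coeff (natval n)^-1) (N.to_nat i + fuel)%N +
     2 * exp_coeff (natval n)^-1 (N.to_nat i + fuel)%N).
Proof.
move=> n0; elim: fuel i t s => [|f IH] i t s ht hs.
  rewrite addn0 exp_inv0; apply: aboveD => //.
  by rewrite /above !natvalM natval1 mulr1 -mulrA ler_wpM2l.
have i1 : N.to_nat (i + 1)%num = (N.to_nat i).+1 by lia.
rewrite exp_invS addnS -addSn -i1; apply: IH.
  rewrite -exp_coeff_inv_succ; apply: above_muldiv => //; lia.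
by rewrite i1 seriesSr; exact: aboveD.
Qed.

Lemma under_exp_inv n fuel i t s : (0 < n)%num ->
  under t (exp_coeff (natval n)^-1 (N.to_nat i)) ->
  under s (series (exp_coeff (natval n)^-1) (N.to_nat i)) ->
  under (exp_inv 0 n fuel i t s)
    (series (exp_coeff (natval n)^-1) (N.to_nat i + fuel)%N).
Proof.
move=> n0; elim: fuel i t s => [|f IH] i t s ht hs.
  by rewrite addn0 exp_inv0 N.mul_0_r N.mul_0_l N.add_0_r.
have i1 : N.to_nat (i + 1)%num = (N.to_nat i).+1 by lia.
rewrite exp_invS addnS -addSn -i1; apply: IH.
  rewrite -exp_coeff_inv_succ; apply: under_muldiv => //; lia.
by rewrite i1 seriesSr; exact: underD.
Qed.

Lemma above1 : above scale 1.
Proof. by rewrite /above mul1r. Qed.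

Lemma under1 : under scale 1.
Proof. by rewrite /under mul1r. Qed.

Let exp_inv_init n : exp_coeff (natval n)^-1 (N.to_nat 0) = 1 :> R.
Proof. by rewrite exp_coeffE /= expr0 fact0 invr1 mulr1. Qed.

Lemma above_expR_inv n fuel : (0 < n)%num ->
  above (exp_inv 1 n fuel.+2 0 scale 0) (expR (natval n)^-1).
Proof.
move=> n0; have s0 := scale_gt0.
apply: le_trans (above_exp_inv fuel.+2 n0 _ _); last 2 first.
- by rewrite exp_inv_init; exact: above1.
- by rewrite /above /series /= big_geq // mul0r.
rewrite ler_wpM2r ?(ltW s0) //; apply: expR_le_taylor.
  by rewrite invr_ge0 natval_ge0.
have : (natval n)^-1 <= 1 :> R by rewrite invf_le1 ?natval_gt0 // ler1n; lia.
have : 2 <= fuel.+3%:R :> R by rewrite ler_nat.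
rewrite add0n; lra.
Qed.

Lemma under_expR_inv n fuel : (0 < n)%num ->
  under (exp_inv 0 n fuel 0 scale 0) (expR (natval n)^-1).
Proof.
move=> n0; have s0 := scale_gt0.
apply: le_trans (under_exp_inv fuel n0 _ _) _.
- by rewrite exp_inv_init; exact: under1.
- by rewrite /under /series /= big_geq // mul0r.
rewrite ler_wpM2r ?(ltW s0) //; apply: expR_ge_taylor.
by rewrite invr_ge0 natval_ge0.
Qed.

Section Rows.
Variable n : N.
Hypothesis n_gt0 : (0 < n)%num.
Local Notation rho k := (@binomial_ratio R (N.to_nat n) k).

(** Squares have constant second difference 2, so with [exp_odd] and [exp_two] all values follow
    from [expR n^-1] by two multiplications per step. *)
Definition exp_sq (k : nat) : R := expR (k%:R ^+ 2 / (N.to_nat n)%:R).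
Definition exp_odd (k : nat) : R := expR ((2 * k%:R + 1) / (N.to_nat n)%:R).
Definition exp_two : R := expR (2 / (N.to_nat n)%:R).

Lemma exp_sqS k : exp_sq k.+1 = exp_sq k * exp_odd k.
Proof.
have e : k.+1%:R ^+ 2 = k%:R ^+ 2 + (2 * k%:R + 1) :> R.
  by rewrite -[k.+1%:R]natr1; ring.
by rewrite /exp_sq e mulrDl expRD.
Qed.

Lemma exp_oddS k : exp_odd k.+1 = exp_odd k * exp_two.
Proof.
have e : 2 * k.+1%:R + 1 = 2 * k%:R + 1 + 2 :> R.
  by rewrite -[k.+1%:R]natr1; ring.
by rewrite /exp_odd e mulrDl expRD.
Qed.

Lemma exp_sq0 : exp_sq 0 = 1.
Proof. by rewrite /exp_sq expr0n mul0r expR0. Qed.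

Lemma exp_odd0 : exp_odd 0 = expR (natval n)^-1.
Proof. by rewrite /exp_odd mulr0 add0r mul1r. Qed.

Lemma exp_twoE : exp_two = expR (natval n)^-1 * expR (natval n)^-1.
Proof. by rewrite -expRD /exp_two /natval; congr expR; ring. Qed.

Let rho_stepE k : rho (N.to_nat k) * natval (n - k)%num / natval (n + k + 1)%num =
  rho (N.to_nat (k + 1)%num).
Proof.
have -> : N.to_nat (k + 1)%num = (N.to_nat k).+1 by lia.
rewrite rhoS /natval N2Nat.inj_sub.
by have -> : N.to_nat (n + k + 1)%num = (N.to_nat n + N.to_nat k).+1 by lia.
Qed.

Lemma above_rho_step k a : above a (rho (N.to_nat k)) ->
  above (rho_step 1 n k a) (rho (N.to_nat (k + 1)%num)).
Proof. by move=> ha; rewrite -rho_stepE; apply: above_muldiv => //; lia. Qed.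

Lemma under_rho_step k a : under a (rho (N.to_nat k)) ->
  under (rho_step 0 n k a) (rho (N.to_nat (k + 1)%num)).
Proof. by move=> ha; rewrite -rho_stepE; apply: under_muldiv => //; lia. Qed.

(** All roundings work against the test: [a], [c], [e] up and [b] down. If the left side of the
    conclusion is negative, where rounding [e] up would help, the conclusion is trivial. *)
Lemma upper_test (cn cd a b c e : N) (r1 r2 r3 q : R) : (0 < cd)%num -> 0 < q ->
  (cd * (a + c) * e <=? cn * (scale * scale) + cd * b * e)%num ->
  above a r1 -> under b r2 -> above c r3 -> above e q ->
  r1 - r2 + r3 <= natval cn / natval cd / q.
Proof.
move=> cd0 q0 /N.leb_le /natval_le.
rewrite /above /under !(natvalM, natvalD).
have := natval_gt0 cd0; have := scale_gt0.
move: (natval scale) (natval a) (natval b) (natval c) (natval e) (natval cn)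
  (natval cd) (natval_ge0 cn) (natval_ge0 e) => s A B C E U V U0 E0 s0 V0 h hA hB hC hE.
rewrite -mulrA -invfM ler_pdivlMr ?mulr_gt0 //.
have [D0|D0] := lerP (r1 - r2 + r3) 0.
  by rewrite (le_trans _ U0) // mulr_le0_ge0 // mulr_ge0 ?ltW.
have hD : (r1 - r2 + r3) * s <= A + C - B by rewrite mulrDl mulrBl; lra.
have := ler_pM (mulr_ge0 (ltW D0) (ltW s0)) (mulr_ge0 (ltW q0) (ltW s0)) hD hE.
move=> /(ler_wpM2l (ltW V0)) hV.
rewrite -(ler_pM2r (mulr_gt0 s0 s0)); apply: le_trans (_ : _ <= V * ((A + C - B) * E)) _.
  by rewrite (le_trans _ hV) // le_eqVlt; apply/orP; left; apply/eqP; ring.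
by rewrite mulrBl mulrBr !mulrA in h *; lra.
Qed.

Lemma upper_row_sound cn cd g2 fuel k a b c e g : (0 < cd)%num ->
  upper_row bits n cn cd g2 fuel k a b c e g ->
  above a (rho (N.to_nat k)) -> under b (rho (2 * N.to_nat k)) ->
  above c (rho (3 * N.to_nat k)) ->
  above e (exp_sq (N.to_nat k)) -> above g (exp_odd (N.to_nat k)) ->
  above g2 exp_two ->
  forall j, (N.to_nat k <= j)%N -> (j ^ 2 < 3 * N.to_nat n + 4)%N ->
    (69 * N.to_nat n < 100 * j ^ 2)%N ->
    rho j - rho (2 * j) + rho (3 * j) <= natval cn / natval cd / exp_sq j.
Proof.
move=> cd0; elim: fuel k a b c e g => [//|f IH] k a b c e g; rewrite upper_rowS.
case: N.leb_spec => [hk|hk].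
  move=> _ _ _ _ _ _ _ j kj; rewrite -mulnn => jn _; exfalso.
  have := leq_mul kj kj; lia.
case: ifP => // test next ha hb hc he hg hg2 j kj jn nj.
have [ekj|nkj] := eqVneq (N.to_nat k) j.
  move: test; case: N.ltb_spec => [_|]; last first.
    by move: nj; rewrite -ekj -mulnn; lia.
  move=> {}test; rewrite -ekj; apply: (upper_test cd0 _ test ha hb hc he).
  exact: expR_gt0.
have k1 : N.to_nat (k + 1)%num = (N.to_nat k).+1 by lia.
apply: (IH _ _ _ _ _ _ next) => //; try by lia.
- exact: above_rho_step.
- have -> : (2 * N.to_nat (k + 1) = N.to_nat (2 * k + 1 + 1))%N by lia.
  do 2! apply: under_rho_step.
  by have -> : N.to_nat (2 * k) = (2 * N.to_nat k)%N by lia.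
- have -> : (3 * N.to_nat (k + 1) = N.to_nat (3 * k + 2 + 1))%N by lia.
  apply: above_rho_step; have -> : (3 * k + 2 = 3 * k + 1 + 1)%num by lia.
  do 2! apply: above_rho_step.
  by have -> : N.to_nat (3 * k) = (3 * N.to_nat k)%N by lia.
- by rewrite k1 exp_sqS; apply: above_fixmul => //; exact: expR_ge0.
- by rewrite k1 exp_oddS; apply: above_fixmul => //; exact: expR_ge0.
Qed.

Lemma upper_check_sound cn cd : (0 < cd)%num -> upper_check bits n cn cd ->
  forall j, (j ^ 2 < 3 * N.to_nat n + 4)%N -> (69 * N.to_nat n < 100 * j ^ 2)%N ->
    rho j - rho (2 * j) + rho (3 * j) <= natval cn / natval cd / exp_sq j.
Proof.
move=> cd0 chk j jn nj; have hg := @above_expR_inv n 8 n_gt0.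
have hg2 : above (fixmul 1 (exp_inv 1 n 10 0 scale 0) (exp_inv 1 n 10 0 scale 0)) exp_two.
  by rewrite exp_twoE; apply: (above_fixmul _ _ hg hg); exact: expR_ge0.
have h1 : above scale (rho (N.to_nat 0)) by rewrite rho0; exact: above1.
have h2 : under scale (rho (2 * N.to_nat 0)) by rewrite muln0 rho0; exact: under1.
have h3 : above scale (rho (3 * N.to_nat 0)) by rewrite muln0 rho0; exact: above1.
have h4 : above scale (exp_sq (N.to_nat 0)) by rewrite exp_sq0; exact: above1.
rewrite -exp_odd0 in hg.
exact: (upper_row_sound cd0 chk h1 h2 h3 h4 hg hg2 (leq0n j) jn nj).
Qed.

Lemma lower_test (a b e : N) (r1 r2 q : R) : 0 < q ->
  (scale * scale + b * e <? a * e)%num ->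
  under a r1 -> above b r2 -> under e q -> q^-1 < r1 - r2.
Proof.
move=> q0 /N.ltb_lt /natval_lt.
rewrite /above /under !(natvalM, natvalD).
have := scale_gt0.
move: (natval scale) (natval a) (natval b) (natval e) (natval_ge0 e)
  => s A B E E0 s0 h hA hB hE.
have qs : 0 < q * s by exact: mulr_gt0.
have AB : 0 <= A - B.
  have : 0 < (A - B) * E by rewrite mulrBl; have := mulr_gt0 s0 s0; lra.
  have [//|AB] := lerP 0 (A - B).
  by rewrite ltNge mulr_le0_ge0 // ltW.
have hD : A - B <= (r1 - r2) * s by rewrite mulrBl; lra.
have hM := ler_pM AB E0 hD hE.
rewrite -[q^-1]mul1r ltr_pdivrMr // -(ltr_pM2r (mulr_gt0 s0 s0)) mul1r.
apply: lt_le_trans (_ : _ < (A - B) * E) _; first by rewrite mulrBl; lra.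
by rewrite (le_trans hM) // le_eqVlt; apply/orP; left; apply/eqP; ring.
Qed.

Lemma lower_row_sound g2 fuel k a b e g :
  lower_row bits n g2 fuel k a b e g ->
  under a (rho (N.to_nat k)) -> above b (rho (2 * N.to_nat k)) ->
  under e (exp_sq (N.to_nat k)) -> under g (exp_odd (N.to_nat k)) ->
  under g2 exp_two ->
  exists j, (exp_sq j)^-1 < rho j - rho (2 * j).
Proof.
elim: fuel k a b e g => [//|f IH] k a b e g; rewrite lower_rowS.
case: ifP => [test _ ha hb he hg hg2|_ next ha hb he hg hg2].
  by exists (N.to_nat k); apply: (lower_test _ test ha hb he); exact: expR_gt0.
have k1 : N.to_nat (k + 1)%num = (N.to_nat k).+1 by lia.
apply: (IH _ _ _ _ _ next) => //.
- exact: under_rho_step.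
- have -> : (2 * N.to_nat (k + 1) = N.to_nat (2 * k + 1 + 1))%N by lia.
  do 2! apply: above_rho_step.
  by have -> : N.to_nat (2 * k) = (2 * N.to_nat k)%N by lia.
- by rewrite k1 exp_sqS; apply: under_fixmul.
- by rewrite k1 exp_oddS; apply: under_fixmul.
Qed.

(** The range of [j] follows from the strict inequality: at j = 0 its right side vanishes, and for j
    > n it is at most 0. *)
Lemma lower_check_sound : lower_check bits n ->
  exists j, (1 <= j <= N.to_nat n)%N /\ (exp_sq j)^-1 < rho j - rho (2 * j).
Proof.
move=> chk; have hg := @under_expR_inv n 10 n_gt0.
have hg2 : under (fixmul 0 (exp_inv 0 n 10 0 scale 0) (exp_inv 0 n 10 0 scale 0)) exp_two.
  by rewrite exp_twoE; exact: (under_fixmul hg hg).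
have h1 : under scale (rho (N.to_nat 0)) by rewrite rho0; exact: under1.
have h2 : above scale (rho (2 * N.to_nat 0)) by rewrite muln0 rho0; exact: above1.
have h3 : under scale (exp_sq (N.to_nat 0)) by rewrite exp_sq0; exact: under1.
rewrite -exp_odd0 in hg.
have [j hj] := lower_row_sound chk h1 h2 h3 hg hg2.
have e0 : 0 < (exp_sq j)^-1 by rewrite invr_gt0 expR_gt0.
exists j; split => //; case: j hj e0 => [|j] hj e0.
  by move: hj; rewrite muln0 subrr ltNge ltW.
rewrite /= leqNgt; apply/negP => nj.
have h4 := @rho_ge0 R (N.to_nat n) (2 * j.+1).
by move: hj; rewrite (@rho_eq0 R _ _ nj) sub0r; lra.
Qed.

End Rows.

End FixedPoint.

(** * Numerical values of the exponential *)

Section NumericalExp.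
Context {R : realType}.

Let series_exp_coeffS (x : R) m :
  series (exp_coeff x) m.+1 = series (exp_coeff x) m + (m`!)%:R^-1 * x ^+ m.
Proof. by rewrite seriesSr exp_coeffE. Qed.

Let series_exp_coeff0 (x : R) : series (exp_coeff x) 0 = 0.
Proof. by rewrite /series /= big_geq. Qed.

Lemma expR1_ge : 5 / 2 <= expR 1 :> R.
Proof.
apply: le_trans (expR_ge_taylor 3 _) => //.
rewrite !series_exp_coeffS series_exp_coeff0 !expr1n !factS fact0 !muln1; lra.
Qed.

Lemma expR_69_100_le : expR (69 / 100) <= 2 :> R.
Proof.
apply: le_trans (expR_le_taylor (m := 5) _ _) _; try lra.
rewrite !series_exp_coeffS series_exp_coeff0 exp_coeffE /= !factS fact0 !muln1.
rewrite -[(3 * 2)%N]/6%N -[(4 * 6)%N]/24%N -[(5 * 24)%N]/120%N.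
lra.
Qed.

(** 17 / 2 is 3 x at the tangent point x = 17 / 6. A Taylor bound for [expR (1 / 2)] is squared four
    times, with rational upper bounds kept small along the way. *)
Lemma expR_17_2_le : expR (17 / 2) <= 499 * 10 :> R.
Proof.
have h : expR (1 / 2) <= 33 / 20 :> R.
  apply: le_trans (expR_le_taylor (m := 5) _ _) _; try lra.
  rewrite !series_exp_coeffS series_exp_coeff0 exp_coeffE /= !factS fact0 !muln1.
  rewrite -[(3 * 2)%N]/6%N -[(4 * 6)%N]/24%N -[(5 * 24)%N]/120%N.
  lra.
have e0 := expR_ge0 (1 / 2 : R).
have -> : 17 / 2 = 1 / 2 + 16%:R * (1 / 2) :> R by field.
rewrite expRD expRM_natl.
have sq m (c d : R) : 0 <= c -> c ^+ 2 <= d -> expR (1 / 2) ^+ m <= c ->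
    expR (1 / 2) ^+ (m * 2) <= d.
  move=> c0 cd h'; apply: le_trans cd; rewrite exprM.
  by rewrite ler_pXn2r ?nnegrE ?exprn_ge0.
have h2 : expR (1 / 2) ^+ 2 <= 1089 / 400 :> R by apply: (sq 1%N (33 / 20)) => //; lra.
have h4 : expR (1 / 2) ^+ 4 <= 593 / 80 :> R by apply: (sq 2%N _ _ _ _ h2); lra.
have h8 : expR (1 / 2) ^+ 8 <= 1099 / 20 :> R by apply: (sq 4%N _ _ _ _ h4); lra.
have h16 : expR (1 / 2) ^+ 16 <= 302 * 10 :> R by apply: (sq 8%N _ _ _ _ h8); lra.
apply: (le_trans (ler_pM _ _ h h16)); rewrite ?exprn_ge0 //; lra.
Qed.

End NumericalExp.

(** * The DKW inequality reduced to binomial ratios *)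

Section Reduction.
Context {R : realType}.
Local Notation rho := (@binomial_ratio R).

Lemma KS_value_le (n k c : nat) : (0 < n)%N ->
  (KS_value R n k <= KS_value R n c) = (k <= c)%N.
Proof.
move=> n0; rewrite /KS_value ler_pM2r ?ler_nat // invr_gt0 sqrtr_gt0.
by rewrite mulr_gt0 ?ltr0n.
Qed.

Lemma KS_value_sq (n k : nat) : (0 < n)%N ->
  - 2 * KS_value R n k ^+ 2 = - (k%:R ^+ 2 / n%:R).
Proof.
move=> n0; have n0' : 0 < n%:R :> R by rewrite ltr0n.
rewrite /KS_value expr_div_n sqr_sqrtr; last by rewrite mulr_ge0 ?ltW.
by field; rewrite lt0r_neq0.
Qed.

Lemma KS_threshold (n : nat) (M : R) : (0 < n)%N -> 0 < M ->
  exists2 k, (0 < k)%N & forall c, (M <= KS_value R n c) = (k <= c)%N.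
Proof.
move=> n0 M0; have n0' : 0 < n%:R :> R by rewrite ltr0n.
have s0 : 0 < Num.sqrt (2 * n%:R) :> R by rewrite sqrtr_gt0 mulr_gt0.
have ex : exists c, M <= KS_value R n c.
  exists (Num.truncn (M * Num.sqrt (2 * n%:R))).+1.
  by rewrite /KS_value ler_pdivlMr // ltW // truncnS_gt.
case: (ex_minnP ex) => k Mk kmin; exists k.
  by rewrite lt0n; apply: contraTneq Mk => ->; rewrite /KS_value mul0r -ltNge.
move=> c; apply/idP/idP => [/kmin //|kc].
by rewrite (le_trans Mk) // KS_value_le.
Qed.

(** Raising [M] to the next lattice value keeps the event and lowers the bound, so lattice values
    suffice. Beyond index [n] the probability is 0, as [rho n k = 0]. *)
Lemma DKW_reduction (n : nat) (C : R) : (0 < n)%N ->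
  (forall k, (1 <= k <= n)%N -> forall r : R,
     [/\ r <= 1, r <= 2 * rho n k &
         r <= 2 * (rho n k - rho n (2 * k) + rho n (3 * k))] ->
     r <= C * expR (- (k%:R ^+ 2 / n%:R))) ->
  0 <= C -> DKW n C.
Proof.
move=> n0 hC C0 M M0 d T P X Y H0.
have [k k0 Mk] := KS_threshold n0 M0.
have [r -> [r1 r2 _ r3]] := H0_probability_bounds n0 k0 Mk H0.
rewrite lee_fin; have [nk|kn] := ltnP n k.
  rewrite (le_trans r2) // rho_eq0 // mulr0 mulr_ge0 ?expR_ge0 //.
apply: (@le_trans _ _ (C * expR (- (k%:R ^+ 2 / n%:R)))).
  by apply: hC; [rewrite k0|split].
rewrite ler_wpM2l // ler_expR -KS_value_sq // !mulNr lerN2 ler_pM2l //.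
by rewrite ler_pXn2r ?nnegrE ?(ltW M0) ?Mk // divr_ge0 ?sqrtr_ge0.
Qed.

Lemma DKW_le (n : nat) (C C' : R) : C <= C' -> DKW n C -> DKW n C'.
Proof.
move=> CC h M M0 d T P X Y H0; apply: le_trans (h M M0 d T P X Y H0) _.
by rewrite lee_fin ler_wpM2r ?expR_ge0.
Qed.

(** [C] is half the DKW constant. On the two extreme ranges of [k] it enters only through
    [1 <= C]. *)
Lemma DKW_of_three_terms (n : nat) (C : R) : (2 <= n)%N -> 1 <= C ->
  (forall k, (k ^ 2 < 3 * n + 4)%N -> (69 * n < 100 * k ^ 2)%N ->
     rho n k - rho n (2 * k) + rho n (3 * k) <= C / expR (k%:R ^+ 2 / n%:R)) ->
  DKW n (2 * C).
Proof.
move=> n2 C1 hC; have n0 : (0 < n)%N by apply: leq_trans n2.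
have n0' : 0 < n%:R :> R by rewrite ltr0n.
apply: DKW_reduction => // [k /andP[k1 kn] r [r1 r2 r3]|]; last by lra.
have [small|big] := leqP (100 * k ^ 2) (69 * n).
  have hx : k%:R ^+ 2 / n%:R <= 69 / 100 :> R.
    rewrite ler_pdivrMr //; move: small; rewrite -(ler_nat R) natrM natrX natrM; lra.
  have hE : 2^-1 <= expR (- (k%:R ^+ 2 / n%:R)) :> R.
    rewrite expRN lef_pV2 ?posrE ?expR_gt0 //.
    by rewrite (le_trans _ expR_69_100_le) // ler_expR.
  by rewrite (le_trans r1) //; nra.
have [tail|mid] := leqP (3 * n + 4) (k ^ 2).
  have := @rho_le_expR_tail R n k n2 tail; have := expR_ge0 (- (k%:R ^+ 2 / n%:R) : R).
  by nra.
by have := hC k mid big; rewrite -expRN; lra.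
Qed.

Lemma upper_check_DKW bits n cn cd : (1 < n)%num -> (0 < cd)%num ->
  (cd <= cn)%num -> upper_check bits n cn cd ->
  DKW (N.to_nat n) (2 * (natval cn / natval cd) : R).
Proof.
move=> n1 cd0 cdn chk; apply: DKW_of_three_terms; first by lia.
  by rewrite ler_pdivlMr ?natval_gt0 // mul1r natval_le.
by apply: (@upper_check_sound R bits n _ cn cd); lia.
Qed.

Lemma DKW_two (n : nat) : (700 <= n)%N -> DKW n (2 : R).
Proof.
move=> n700; have n2 : (2 <= n)%N by apply: leq_trans n700.
rewrite -[2]mulr1; apply: DKW_of_three_terms => // k kn nk.
by rewrite mul1r -expRN; exact: (rho_sum_le_expR expR_17_2_le).
Qed.

End Reduction.

(** * Computed ranges of sample sizes *)

Definition check_c (n : N) : bool := upper_check 40 n 1 1.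

Lemma check_c_range : forall_range check_c 242 458.
Proof. by vm_compute. Qed.

(** 216863 / 200000 is half of 2.16863. *)
Definition num_b : N := (2 * (100 * 1000) + 168 * 100 + 63)%num.
Definition den_b : N := (2 * (100 * 1000))%num.

Lemma check_b_range : forall_range (fun n => upper_check 40 n num_b den_b) 8 4.
Proof. by vm_compute. Qed.

(** The ratio 5 / 4 stands for the DKW constant 5 / 2, a rational below e. *)
Lemma check_a_range : forall_range (fun n => upper_check 40 n 5 4) 2 2.
Proof. by vm_compute. Qed.

(* [num_e n / den_e n] is the bound on [1 + delta_n] lowered by [10 ^ -6], which
   makes the inequality for [delta_n] strict. *)
Definition den_e (n : N) : N := (100 * 100 * 100 * (n * n * n))%num.
Definition pos_e (n : N) : N := (den_e n + 40 * (100 * 100 * 100) * n)%num.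
Definition neg_e (n : N) : N :=
  (7 * (100 * 100) * (n * n) + 400 * (100 * 100 * 100) + n * n * n)%num.
Definition num_e (n : N) : N := (pos_e n - neg_e n)%num.

(** The first test makes the subtraction in [num_e] exact, the second gives delta > 0, and the third
    lets the same run prove (b) for this [n]. *)
Definition check_e (n : N) : bool :=
  [&& (neg_e n <=? pos_e n)%num, (den_e n <? num_e n)%num,
      (num_e n * den_b <=? num_b * den_e n)%num &
      upper_check 40 n (num_e n) (den_e n)].

Lemma check_e_range : forall_range check_e 446 12.
Proof. by vm_compute. Qed.

Lemma check_d_range : forall_range (lower_check 40) 457 1.
Proof. by vm_compute. Qed.

Section Constants.
Context {R : realType}.

Lemma natvalB a b : (b <= a)%num -> natval (a - b)%num = natval a - natval b :> R.
Proof. by move=> ba; rewrite /natval N2Nat.inj_sub natrB //; lia. Qed.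

Lemma natval_of_nat n : natval (N.of_nat n) = n%:R :> R.
Proof. by rewrite /natval Nat2N.id. Qed.

Lemma const_bE : 2 * (natval num_b / natval den_b) = 2 + 168 / 10 ^+ 3 + 63 / 10 ^+ 5 :> R.
Proof.
rewrite /num_b /den_b !(natvalD, natvalM).
rewrite -[natval 2]/(2 : R) -[natval 100]/(100 : R) -[natval 1000]/(1000 : R)
  -[natval 168]/(168 : R) -[natval 63]/(63 : R).
lra.
Qed.

Lemma natval_num_e n : (neg_e n <= pos_e n)%num -> natval (num_e n) =
  natval (den_e n) + 40 * (100 * 100 * 100) * natval n
  - (7 * (100 * 100) * natval n ^+ 2 + 400 * (100 * 100 * 100) + natval n ^+ 3) :> R.
Proof.
move=> h; rewrite /num_e natvalB // /pos_e /neg_e !(natvalD, natvalM).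
rewrite -[natval 40]/(40 : R) -[natval 100]/(100 : R) -[natval 7]/(7 : R)
  -[natval 400]/(400 : R); ring.
Qed.

Lemma natval_den_e n : natval (den_e n) = 100 * 100 * 100 * natval n ^+ 3 :> R.
Proof. rewrite /den_e !natvalM -[natval 100]/(100 : R); ring. Qed.

End Constants.

(** * Individual sample sizes and the level 0.05 *)

Section SmallSampleSizes.
Context {R : realType}.
Local Notation rho := (@binomial_ratio R).

Lemma check_e_DKW (n : nat) : (12 <= n < 458)%N ->
  exists delta : R, [/\ 0 < delta, DKW n (2 * (1 + delta)),
    2 * (1 + delta) <= 2 + 168 / 10 ^+ 3 + 63 / 10 ^+ 5 &
    delta < - (7 / 100) / n%:R + 40 / n%:R ^+ 2 - 400 / n%:R ^+ 3].
Proof.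
move=> hn; have := forall_rangeP (i := n) check_e_range.
rewrite -[N.to_nat 12]/12%N -[(12 + 446)%N]/458%N => /(_ hn) /and4P[].
move=> /N.leb_le np /N.ltb_lt dn /N.leb_le nb chk.
have d0 : (0 < den_e (N.of_nat n))%num by rewrite /den_e; nia.
have d0' := natval_gt0 d0 : 0 < natval (den_e (N.of_nat n)) :> R.
have n0 : 0 < n%:R :> R by rewrite ltr0n; lia.
pose q : R := natval (num_e (N.of_nat n)) / natval (den_e (N.of_nat n)).
have e : 1 + (q - 1) = q by rewrite addrC subrK.
exists (q - 1); rewrite e; split.
- by rewrite subr_gt0 ltr_pdivlMr // mul1r natval_lt.
- have := upper_check_DKW (R := R) (n := N.of_nat n) _ d0 _ chk.
  by rewrite Nat2N.id; apply; lia.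
- rewrite -const_bE ler_pM2l // ler_pdivrMr // mulrAC ler_pdivlMr ?natval_gt0 //.
  by rewrite -!natvalM natval_le.
- rewrite /q natval_num_e // natval_den_e natval_of_nat.
  rewrite -subr_gt0.
  set lhs := (X in 0 < X).
  have -> : lhs = (100 * 100 * 100)^-1.
    by rewrite /lhs; field; rewrite lt0r_neq0.
  by rewrite invr_gt0 !mulr_gt0.
Qed.

Lemma DKW_b (n : nat) : (4 <= n < 458)%N ->
  DKW n (2 + 168 / 10 ^+ 3 + 63 / 10 ^+ 5 : R).
Proof.
move=> /andP[n4 n458]; have [n12|n12] := ltnP n 12.
  have := forall_rangeP (i := n) check_b_range.
  rewrite -[N.to_nat 4]/4%N -[(4 + 8)%N]/12%N n4 => /(_ n12) chk.
  have := upper_check_DKW (R := R) (n := N.of_nat n) _ _ _ chk.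
  by rewrite Nat2N.id const_bE; apply; rewrite /num_b /den_b; lia.
have [|delta [_ h hb _]] := @check_e_DKW n; first by rewrite n12.
exact: DKW_le hb h.
Qed.

(** At n = k = 1 the bound e exp(- 1) equals 1, so the trivial estimate is exact and a rational
    constant below e would fail. *)
Lemma DKW_a1 : DKW 1 (expR 1 : R).
Proof.
apply: DKW_reduction => //.
move=> k; rewrite -eqn_leq eq_sym => /eqP -> r [r1 _ _].
by rewrite -expRD expr1n divr1 subrr expR0.
Qed.

Lemma DKW_a (n : nat) : (1 <= n < 4)%N -> DKW n (expR 1 : R).
Proof.
move=> /andP[n1 n4]; have [n2|n2] := leqP n 1.
  have -> : n = 1%N by lia.
  exact: DKW_a1.
have := forall_rangeP (i := n) check_a_range.
rewrite -[N.to_nat 2]/2%N -[(2 + 2)%N]/4%N n2 => /(_ n4) chk.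
apply: DKW_le (_ : 2 * (natval 5 / natval 4) <= expR 1) _.
  by rewrite -[natval 5]/(5 : R) -[natval 4]/(4 : R); have := @expR1_ge R; lra.
have := upper_check_DKW (R := R) (n := N.of_nat n) _ _ _ chk.
by rewrite Nat2N.id; apply; lia.
Qed.

Lemma DKW_c (n : nat) : (458 <= n)%N -> DKW n (2 : R).
Proof.
move=> n458; have [n700|] := ltnP n 700; last exact: DKW_two.
have := forall_rangeP (i := n) check_c_range.
rewrite -[N.to_nat 458]/458%N -[(458 + 242)%N]/700%N n458 => /(_ n700) chk.
have := upper_check_DKW (R := R) (n := N.of_nat n) _ _ _ chk.
by rewrite Nat2N.id natval1 divr1 mulr1; apply; lia.
Qed.

Lemma exceeds_two (n : nat) : (1 <= n < 458)%N ->
  exists k : nat, (1 <= k <= n)%N /\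
    under_H0 n (KS_value R n k) (fun p =>
      ((2 * expR (- 2 * KS_value R n k ^+ 2))%:E < p)%E).
Proof.
move=> /andP[n1 n458].
have := forall_rangeP (i := n) check_d_range.
rewrite -[N.to_nat 1]/1%N -[(1 + 457)%N]/458%N n1 => /(_ n458) chk.
have [|j [/andP[j1 jn]]] := @lower_check_sound R 40 (N.of_nat n) _ chk; first by lia.
rewrite Nat2N.id in jn * => hj.
exists j; split; first by rewrite j1.
move=> d T P X Y H0.
have [r -> [_ _ hr _]] := H0_probability_bounds n1 j1 (fun c => KS_value_le j c n1) H0.
rewrite lte_fin KS_value_sq //; apply: lt_le_trans hr.
by rewrite ltr_pM2l // expRN; move: hj; rewrite /exp_sq Nat2N.id.
Qed.

Lemma rho_value (n k : nat) a b : 'C(n + n, n + k) = a -> 'C(n + n, n) = b ->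
  rho n k = a%:R / b%:R :> R.
Proof. by rewrite /binomial_ratio => -> ->. Qed.

(** At the largest possible value the one-term bound is 2 / 70. *)
Lemma rejects_at_4 : under_H0 4 (KS_value R 4 4) (fun p => (p <= (5 / 100 : R)%:E)%E).
Proof.
move=> d T P X Y H0.
have threshold c := @KS_value_le R 4 4 c isT.
have [r -> [_ hr _ _]] := @H0_probability_bounds R 4 4 _ isT isT threshold _ _ _ _ _ H0.
rewrite lee_fin; apply: (le_trans hr).
by rewrite (@rho_value 4 4 1 70) //; lra.
Qed.

(** The smallest of the six cases is n = k = 3, with value 2 / 20. *)
Lemma rho_gap_below_4 (n k : nat) : (1 <= n < 4)%N -> (1 <= k <= n)%N ->
  5 / 100 < 2 * (rho n k - rho n (2 * k)) :> R.
Proof.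
case: n => [|[|[|[|n]]]] //; case: k => [|[|[|[|k]]]] // _ _.
- by rewrite (@rho_value 1 1 1 2) // (@rho_value 1 2 0 2) //; lra.
- by rewrite (@rho_value 2 1 4 6) // (@rho_value 2 2 1 6) //; lra.
- by rewrite (@rho_value 2 2 1 6) // (@rho_value 2 4 0 6) //; lra.
- by rewrite (@rho_value 3 1 15 20) // (@rho_value 3 2 6 20) //; lra.
- by rewrite (@rho_value 3 2 6 20) // (@rho_value 3 4 0 20) //; lra.
by rewrite (@rho_value 3 3 1 20) // (@rho_value 3 6 0 20) //; lra.
Qed.

Lemma accepts_below_4 (n k : nat) : (1 <= n < 4)%N -> (1 <= k <= n)%N ->
  under_H0 n (KS_value R n k) (fun p => ((5 / 100 : R)%:E < p)%E).
Proof.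
move=> hn hk; have [/andP[n1 _] /andP[k1 _]] := (hn, hk).
move=> d T P X Y H0.
have [r -> [_ _ hr _]] := H0_probability_bounds n1 k1 (fun c => KS_value_le k c n1) H0.
by rewrite lte_fin; apply: lt_le_trans hr; exact: rho_gap_below_4.
Qed.

End SmallSampleSizes.
Unset Implicit Arguments.

Theorem theorem1 (R : realType) :
  (* (a) *)
  (forall n : nat, (1 <= n)%N -> DKW n (expR 1 : R)) /\
  (* (b): 2.16863, split because the numerals are unary *)
  (forall n : nat, (4 <= n)%N -> DKW n (2 + 168 / 10 ^+ 3 + 63 / 10 ^+ 5 : R)) /\
  (* (b), parenthetical remark: 4 is the smallest n for which H_0 can be
     rejected at level 0.05 *)
  ((exists k : nat, (1 <= k <= 4)%N /\
      under_H0 4 (KS_value R 4 k) (fun p => (p <= (5 / 100 : R)%:E)%E)) /\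
   (forall n k : nat, (1 <= n < 4)%N -> (1 <= k <= n)%N ->
      under_H0 n (KS_value R n k) (fun p => ((5 / 100 : R)%:E < p)%E))) /\
  (* (c) *)
  (forall n : nat, (458 <= n)%N -> DKW n (2 : R)) /\
  (* (d) *)
  (forall n : nat, (1 <= n < 458)%N ->
     exists k : nat, (1 <= k <= n)%N /\
       under_H0 n (KS_value R n k) (fun p =>
         ((2 * expR (- 2 * KS_value R n k ^+ 2))%:E < p)%E)) /\
  (* (e) *)
  (forall n : nat, (1 <= n < 458)%N ->
     exists delta : R, 0 < delta /\
       DKW n (2 * (1 + delta)) /\
       ((12 <= n)%N ->
          delta < - (7 / 100) / n%:R + 40 / n%:R ^+ 2 - 400 / n%:R ^+ 3)).
Proof.
have e_ge := @expR1_ge R.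
have hb n : (4 <= n)%N -> DKW n (2 + 168 / 10 ^+ 3 + 63 / 10 ^+ 5 : R).
  move=> n4; have [n458|n458] := ltnP n 458; first by apply: DKW_b; rewrite n4.
  by apply: DKW_le (DKW_c n458); lra.
have ha n : (1 <= n)%N -> DKW n (expR 1 : R).
  move=> n1; have [n4|n4] := ltnP n 4; first by apply: DKW_a; rewrite n1.
  by apply: DKW_le (hb n n4); lra.
do 2![split=> //]; split.
  by split; [exists 4%N; split=> //; exact: rejects_at_4 | exact: accepts_below_4].
split; first exact: DKW_c.
split; first exact: exceeds_two.
move=> n /andP[n1 n458]; have [n12|n12] := ltnP n 12.
  (* This choice makes 2 (1 + delta) equal to e, so (a) applies; it is positive because e >= 5 /
     2. *)
  exists (expR 1 / 2 - 1); split; first by lra.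
  split; last by [].
  have -> : 2 * (1 + (expR 1 / 2 - 1)) = expR 1 :> R by lra.
  exact: ha.
have [|delta [d0 h _ hd]] := @check_e_DKW R n; first by rewrite n12.
by exists delta.
Qed.
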